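(* Let $d$ be a positive integer and $n\ge 0$. The transition matrices from the basis $\{h^{[d]}_\lambda:\lambda\vdash n\}$ of $\Lambda^n$ to the classical bases are $$M(h^{[d]},p)=R'z^{-1}D^{[d]},$$ $$M(h^{[d]},m)=R'z^{-1}D^{[d]}R,$$ $$M(h^{[d]},h)=R'D^{[d]}R^{*},$$ $$M(h^{[d]},e)=R'D^{[d]}\varepsilon R^{*},$$ $$M(h^{[d]},s)=R'z^{-1}D^{[d]}RK^{-1}.$$
   Context: $\Lambda^n$ is the space of homogeneous symmetric functions of degree $n$ over $\mathbb{Q}$ in $x=(x_1,x_2,\ldots)$. The truncated homogeneous symmetric functions are defined by $\sum_{n\ge 0}h_n^{[d]}(x)t^n=\prod_{k\ge 1}(1+x_kt+x_k^2t^2+\cdots+x_k^dt^d)$ and $h^{[d]}_\lambda=\prod_i h^{[d]}_{\lambda_i}$. The symbols $m,h,e,p,s$ denote the monomial, complete homogeneous, elementary, power sum symmetric functions and the Schur functions. For families $\{a_\lambda\}_{\lambda\vdash n}$ and $\{b_\lambda\}_{\lambda\vdash n}$ that are bases of $\Lambda^n$, the transition matrix $M(a,b)$, with rows and columns indexed by partitions of $n$, is defined by $a_\lambda=\sum_{\mu\vdash n}M(a,b)_{\lambda\mu}b_\mu$. Put $R=M(p,m)$ and $K=M(s,m)$; $R'$ is the transpose of $R$ and $R^{*}=(R')^{-1}$. $z$, $\varepsilon$ and $D^{[d]}$ are the diagonal matrices with diagonal entries, for $\mu=(1^{n_1},2^{n_2},\ldots)\vdash n$ ($n_i$ parts equal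 to $i$), $z_\mu=\prod_{i\ge1}i^{n_i}n_i!$, $\varepsilon_\mu=(-1)^{|\mu|-\ell(\mu)}$ (with $\ell(\mu)$ the number of nonzero parts), and $D^{[d]}_\mu=(-d)^{\sum_{k\ge1}n_{k(d+1)}}$. *)

(* Defs.v *)
From Stdlib Require Import ClassicalEpsilon.
From HB Require Import structures.
From mathcomp Require Import all_boot all_order all_fingroup all_algebra.
From mathcomp Require Import mpoly.

Set Implicit Arguments.
Unset Strict Implicit.
Unset Printing Implicit Defensive.

Import Order.TTheory GRing.Theory Num.Theory.

Local Open Scope ring_scope.

(* A partition of n, padded with zeros to exactly n weakly decreasing entries;
   this encoding makes it a finType.  Note that a partition of n has at most n
   parts, all of them at most n. *)
Definition is_part n (t : n.-tuple 'I_n.+1) : bool :=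
  sorted geq (map val t) && (sumn (map val t) == n).

Notation part n := {t : n.-tuple 'I_n.+1 | is_part t}.

Definition row_len n (la : part n) (i : 'I_n) : nat := tnth (val la) i.

Definition parts n (la : part n) : seq nat :=
  [seq k <- map val (val la) | k != 0%N].

Definition mult n (i : nat) (la : part n) : nat := count_mem i (parts la).

Definition len n (la : part n) : nat := size (parts la).

(* Symmetric functions in x = (x_1, x_2, ...) are elements of the graded inverse
   limit of the rings of symmetric polynomials in N variables: f is given by its
   truncations f N = f(x_1, ..., x_N, 0, 0, ...), and all algebraic operations
   (and equality) are taken for each N. *)
Definition symfun := forall N : nat, {mpoly rat[N]}.

(* Setting the last variable to 0. *)
Definition kill_last N (f : {mpoly rat[N.+1]}) : {mpoly rat[N]} :=
  f \mPo [tuple oapp (fun j : 'I_N => 'X_j) 0 (unlift ord_max i) | i < N.+1].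

Definition in_Lambda (n : nat) (f : symfun) : Prop :=
  forall N, [/\ f N \is symmetric, f N \is n.-homog
              & kill_last (f N.+1) = f N].

Definition is_basis n (b : part n -> symfun) : Prop :=
  (forall la, in_Lambda n (b la)) /\
  (forall f, in_Lambda n f ->
     exists! c : {ffun part n -> rat},
       forall N, f N = \sum_(la : part n) c la *: b la N).

Definition part_diag n (F : part n -> rat) : 'M[rat]_#|{: part n}| :=
  diag_mx (\row_i F (enum_val i)).

Definition is_transition n (a b : part n -> symfun)
    (M : 'M[rat]_#|{: part n}|) : Prop :=
  forall (la : part n) N,
    a la N = \sum_(mu : part n) M (enum_rank la) (enum_rank mu) *: b mu N.

(* The matrix M(a,b); it exists and is unique when a and b are bases, and is
   only meaningful in that case. *)
Definition transition n (a b : part n -> symfun) : 'M[rat]_#|{: part n}| :=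
  epsilon (inhabits 0) (is_transition a b).

(* Only the nonzero parts contribute: a factor p_0 would not be 1. *)
Definition prod_parts (f : nat -> symfun) n (la : part n) : symfun :=
  fun N => \prod_(k <- parts la) f k N.

Definition complete (k : nat) : symfun :=
  fun N => \sum_(al : 'X_{1..N < k.+1} | mdeg al == k) 'X_[al].

Definition elementary (k : nat) : symfun := fun N => mesym N rat k.

Definition powersum (k : nat) : symfun := fun N => \sum_(i < N) 'X_i ^+ k.

(* h_k^[d], the coefficient of t^k in the product over i of
   1 + x_i t + ... + x_i^d t^d. *)
Definition truncated (d k : nat) : symfun :=
  fun N => (\prod_(i < N) \poly_(j < d.+1) ('X_i ^+ j : {mpoly rat[N]}))`_k.

Definition sym_h n : part n -> symfun := @prod_parts complete n.
Definition sym_e n : part n -> symfun := @prod_parts elementary n.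
Definition sym_p n : part n -> symfun := @prod_parts powersum n.
Definition sym_hd d n : part n -> symfun := @prod_parts (truncated d) n.

(* The sum of all distinct monomials whose exponents, zeros apart, are a
   rearrangement of la. *)
Definition sym_m n (la : part n) : symfun :=
  fun N => \sum_(al : 'X_{1..N < n.+1}
                   | perm_eq [seq k <- (al : 'X_{1..N}) | k != 0%N] (parts la))
             'X_[al].

(* Cells (row, column) of the Young diagram, counted from 0. *)
Definition is_cell n (la : part n) (c : 'I_n * 'I_n) : bool :=
  (c.2 < row_len la c.1)%N.

Notation cell la := {c | is_cell la c}.

(* Weakly increasing along rows, strictly increasing down columns. *)
Definition semistandard n (la : part n) N (T : {ffun cell la -> 'I_N}) : bool :=
  [forall c : cell la, forall c' : cell la,
     (((val c).1 == (val c').1) && ((val c).2 < (val c').2)%N ==> (T c <= T c')%N)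
     && (((val c).2 == (val c').2) && ((val c).1 < (val c').1)%N
           ==> (T c < T c')%N)].

(* Schur functions, as generating functions of semistandard tableaux. *)
Definition sym_s n (la : part n) : symfun :=
  fun N => \sum_(T : {ffun cell la -> 'I_N} | semistandard T)
             \prod_(c : cell la) 'X_(T c).

Definition zval n (mu : part n) : rat :=
  (\prod_(1 <= i < n.+1) (i ^ mult i mu * (mult i mu)`!))%:R.

Definition epsval n (mu : part n) : rat := (-1) ^+ (n - len mu).

(* The sum over all k >= 1 is cut at k = n, beyond which multiplicities vanish. *)
Definition Dval (d n : nat) (mu : part n) : rat :=
  (- d%:R) ^+ (\sum_(1 <= k < n.+1) mult (k * d.+1) mu).

Definition zmx n : 'M[rat]_#|{: part n}| := part_diag (@zval n).
Definition epsmx n : 'M[rat]_#|{: part n}| := part_diag (@epsval n).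
Definition Dmx d n : 'M[rat]_#|{: part n}| := part_diag (@Dval d n).

(* Main.v *)
(** Everything is compared with power sums.  If F(t) = 1 + t + ... + t^d, then
    the coefficient of t^m in t F'(t)/F(t) is -d when d + 1 divides m and 1
    otherwise, so that Newton's recursion for the product of the F(x_i y_j t)
    and the relation p_k(xy) = p_k(x) p_k(y) give Cauchy's identity: the
    coefficient of t^n in this product is the sum over mu of
    z_mu^-1 D_mu p_mu(x) p_mu(y).  Reading off the coefficient of y^la yields
    M(h^[d], p) = R' z^-1 D.  Since h^[1] = e with D^[1] = eps, and
    h^[n]_k = h_k for k <= n with D^[n] = 1, the formulas for h and e are
    instances of this one, and the rest is matrix algebra.  The matrix R is
    triangular because merging parts decreases their number, and K is because an
    entry of a semistandard tableau is at least its row index; Schur functions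
    are symmetric by the Bender-Knuth involution. *)

Require Import Defs.
From mathcomp Require Import all_boot all_order all_fingroup all_algebra.
From mathcomp Require Import mpoly.
From mathcomp Require Import ring zify.

Set Implicit Arguments.
Unset Strict Implicit.
Unset Printing Implicit Defensive.

Import Order.TTheory GRing.Theory Num.Theory.

Local Open Scope ring_scope.

(** * Partitions *)

(** The values 1 and -d come from F = (1 - t^(d+1)) / (1 - t), for which t F'/F = t / (1 - t) -
    (d+1) t^(d+1) / (1 - t^(d+1)). The sum over mu comes from comparing the product of the F(x_i y_j
    t) with a product of exponentials exp(a_m t^m / m), whose expansion has the denominators z_mu.
    Logarithmic derivatives and exponentials are infinite series, but only the coefficient of t^n
    matters, so polynomials are used and their identities are required up to degree n only. An
    element of Lambda^n is determined by its coefficients at the monomials x^la in n variables.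
    Being a basis thus reduces to the invertibility of a finite matrix, and n variables y_j suffice
    in Cauchy's identity. The factor z^-1 disappears from the formulas for h and e because M(h, p) =
    R' z^-1 and M(e, p) = R' z^-1 eps: in the product of R' z^-1 D with their inverses, the diagonal
    matrices commute and z cancels. The Bender-Knuth involution is carried out on Gelfand-Tsetlin
    patterns, where it is a reflection of numbers in intervals and no pairing of tableau entries is
    needed. *)

Lemma sumn_filter_neq0 (s : seq nat) : sumn [seq k <- s | k != 0%N] = sumn s.
Proof. by elim: s => //= x s IH; case: eqP => [->|_] /=; rewrite IH. Qed.

Lemma perm_filter_neq0 (s t : seq nat) : size s = size t ->
  perm_eq [seq k <- s | k != 0%N] [seq k <- t | k != 0%N] -> perm_eq s t.
Proof.
move=> eq_sz eq_st; rewrite -(perm_filterC (predC1 0%N) s) perm_sym.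
rewrite -(perm_filterC (predC1 0%N) t) perm_sym; apply: perm_cat => //.
have eq0 (u : seq nat) : [seq k <- u | predC (predC1 0%N) k] =
    nseq (size u - size [seq k <- u | k != 0%N]) 0%N.
  elim: u => //= k u IH; rewrite negbK; case: eqP => [->|_] /=; rewrite IH.
    by rewrite subSn // size_filter count_size.
  by rewrite subSS.
by rewrite !eq0 eq_sz (perm_size eq_st).
Qed.

Lemma sumn_parts n (la : part n) : sumn (parts la) = n.
Proof. by rewrite sumn_filter_neq0; case/andP: (valP la) => _ /eqP. Qed.

Lemma parts_neq0 n (la : part n) k : k \in parts la -> k != 0%N.
Proof. by rewrite mem_filter => /andP[]. Qed.

Lemma perm_parts_inj n (la mu : part n) :
  perm_eq (parts la) (parts mu) -> la = mu.
Proof.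
move=> eq_lm; apply/val_inj/val_inj/(inj_map val_inj).
have/andP[la_sorted _] := valP la; have/andP[mu_sorted _] := valP mu.
apply: (sorted_eq _ _ la_sorted mu_sorted).
- by move=> a b c /= ba cb; apply: leq_trans cb ba.
- by move=> a b /andP[ba ab]; apply: anti_leq; rewrite [(a <= b)%N]ab [(b <= a)%N]ba.
by apply: perm_filter_neq0; rewrite ?size_map ?size_tuple.
Qed.

Lemma size_leq_sumn (s : seq nat) : 0%N \notin s -> (size s <= sumn s)%N.
Proof.
elim: s => //= x s IH; rewrite inE negb_or eq_sym -lt0n => /andP[x_gt0 /IH].
by rewrite -addn1 addnC => ?; apply: leq_add.
Qed.

Lemma leq_mem_sumn (s : seq nat) k : k \in s -> (k <= sumn s)%N.
Proof.
elim: s => //= x s IH; rewrite inE => /orP[/eqP->|/IH le_ks].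
  exact: leq_addr.
exact: leq_trans le_ks (leq_addl _ _).
Qed.

Lemma exists_part n (s : seq nat) : 0%N \notin s -> sumn s = n ->
  exists la : part n, perm_eq (parts la) s.
Proof.
move=> s_neq0 sum_s.
have sz_s : (size s <= n)%N by rewrite -sum_s size_leq_sumn.
pose s' := sort geq (s ++ nseq (n - size s) 0%N).
have sz_s' : size s' = n by rewrite size_sort size_cat size_nseq subnKC.
have perm_s' : perm_eq s' (s ++ nseq (n - size s) 0%N) by rewrite perm_sort.
have sum_s' : sumn s' = n.
  by rewrite (perm_sumn perm_s') sumn_cat sumn_nseq mul0n addn0.
pose t : n.-tuple 'I_n.+1 := [tuple inord (nth 0%N s' i) | i < n].
have val_t : map val t = s'.
  apply: (@eq_from_nth _ 0%N); rewrite size_map size_tuple ?sz_s' // => i lt_in.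
  rewrite (nth_map ord0) ?size_tuple // -(tnth_nth _ _ (Ordinal lt_in)).
  rewrite tnth_mktuple /= inordK // ltnS -[leqRHS]sum_s' leq_mem_sumn //.
  by rewrite mem_nth ?sz_s'.
have t_part : is_part t.
  by rewrite /is_part val_t sum_s' eqxx sort_sorted // => a b; apply: leq_total.
exists (Sub t t_part); rewrite /parts SubK val_t.
apply: perm_trans (perm_filter _ perm_s') _.
rewrite filter_cat (_ : [seq k <- nseq _ _ | _] = [::]); last first.
  by elim: (n - size s)%N.
rewrite cats0 (all_filterP _) //; apply/allP => k k_s.
by apply: contraNneq s_neq0 => <-.
Qed.

(** * Monomial symmetric functions *)

Notation nonzero s := [seq k <- s | k != 0%N].

(** The exponent of x^la in exactly n variables, which is enough room for every partition of n. *)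
Definition mnm_part n (la : part n) : 'X_{1..n} := [multinom row_len la i | i < n].

Lemma nonzero_mnm_part n (la : part n) : nonzero (mnm_part la) = parts la.
Proof.
rewrite /parts; congr (nonzero _); apply: (@eq_from_nth _ 0%N).
  by rewrite size_map !size_tuple.
move=> i; rewrite size_tuple => lt_in.
rewrite (nth_map ord0) ?size_tuple // -[i]/(val (Ordinal lt_in)).
by rewrite -mnm_nth mnmE /row_len (tnth_nth ord0).
Qed.

Lemma mdeg_sumn N (a : 'X_{1..N}) : mdeg a = sumn a.
Proof. by rewrite /mdeg sumnE. Qed.

Lemma sumn_nonzero N (a : 'X_{1..N}) : sumn (nonzero a) = mdeg a.
Proof. by rewrite sumn_filter_neq0 mdeg_sumn. Qed.

Lemma mdeg_mnm_part n (la : part n) : mdeg (mnm_part la) = n.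
Proof. by rewrite -sumn_nonzero nonzero_mnm_part sumn_parts. Qed.

Lemma exists_part_mnm N (a : 'X_{1..N}) :
  exists la : part (mdeg a), perm_eq (nonzero a) (parts la).
Proof.
have [|la] := @exists_part (mdeg a) (nonzero a) _ (sumn_nonzero a).
  by rewrite mem_filter eqxx.
by rewrite perm_sym; exists la.
Qed.

Lemma nonzero_mnmwiden N (a : 'X_{1..N}) : nonzero (mnmwiden a) = nonzero a.
Proof. by rewrite /= filter_rcons eqxx. Qed.

Lemma widen_ord_lift N (i : 'I_N) : widen_ord (leqnSn N) i = lift ord_max i.
Proof. by apply: val_inj; rewrite /= /bump leqNgt ltn_ord. Qed.

Lemma kill_lastX N (b : 'X_{1..N.+1}) : kill_last 'X_[b] =
  'X_[[multinom b (widen_ord (leqnSn N) i) | i < N]] *+ (b ord_max == 0%N).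
Proof.
rewrite /kill_last comp_mpolyX big_ord_recr /= tnth_mktuple unlift_none /=.
rewrite expr0n mulr_natr mpolyXE_id; congr (_ *+ _); apply: eq_bigr => i _.
rewrite mnmE widen_ord_lift.
by rewrite tnth_mktuple liftK.
Qed.

Lemma mcoeff_kill_last N (f : {mpoly rat[N.+1]}) (a : 'X_{1..N}) :
  (kill_last f)@_a = f@_(mnmwiden a).
Proof.
rewrite /kill_last comp_mpolyEX [f in RHS]mpolyE !raddf_sum /=.
apply: eq_bigr => b _; rewrite !mcoeffZ -/(kill_last _) kill_lastX mcoeffMn.
rewrite !mcoeffX -mulrnA mulnb; congr (_ * _%:R).
 congr (nat_of_bool _); apply/andP/eqP.
  case=> /eqP <- /eqP b0; apply/mnmP=> i.
  case: (unliftP ord_max i) => [j ->|->]; last by rewrite mnmwiden_ordmax b0.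
  by rewrite -widen_ord_lift mnmwiden_widen mnmE.
move=> ->; rewrite mnmwiden_ordmax; split=> //; apply/eqP/mnmP => i.
by rewrite mnmE mnmwiden_widen.
Qed.

Lemma mnm_permP N (a b : 'X_{1..N}) : perm_eq (nonzero a) (nonzero b) ->
  exists s : 'S_N, a = [multinom b (s i) | i < N].
Proof.
move=> /perm_filter_neq0; rewrite !size_tuple => /(_ erefl)/tuple_permP[s eq_ab].
exists s; apply/mnmP=> i; rewrite mnmE !(mnm_nth 0%N) eq_ab nth_mktuple.
by rewrite (tnth_nth 0%N).
Qed.

Lemma Lambda_widen n f N (a : 'X_{1..N}) M : in_Lambda n f -> (N <= M)%N ->
  exists b : 'X_{1..M}, nonzero b = nonzero a /\ (f M)@_b = (f N)@_a.
Proof.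
move=> fL; elim: M => [|M IH].
  by rewrite leqn0 => /eqP N0; subst N; exists a.
rewrite leq_eqVlt => /orP[/eqP NM|/IH[b [eq_ba eq_f]]]; first by subst N; exists a.
exists (mnmwiden b); rewrite nonzero_mnmwiden; split=> //.
by rewrite -mcoeff_kill_last; case: (fL M) => _ _ ->.
Qed.

(** Both exponents are widened by zeros to [maxn N M] variables, which keeps the coefficients by
    compatibility with truncation; there they differ by a permutation, and symmetry applies. *)
Lemma Lambda_mcoeff n f N M (a : 'X_{1..N}) (b : 'X_{1..M}) : in_Lambda n f ->
  perm_eq (nonzero a) (nonzero b) -> (f N)@_a = (f M)@_b.
Proof.
move=> fL.
have [a' [<- <-]] := Lambda_widen a fL (leq_maxl N M).
have [b' [<- <-]] := Lambda_widen b fL (leq_maxr N M).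
case/mnm_permP=> s ->; apply: msym_coeff.
by case: (fL (maxn N M)).
Qed.

Lemma mcoeff_sym_m n (la : part n) N (a : 'X_{1..N}) :
  (sym_m la N)@_a = (perm_eq (nonzero a) (parts la))%:R.
Proof.
rewrite /sym_m raddf_sum /=; case: (boolP (perm_eq _ _)) => [ala|nala].
  have lt_a : (mdeg a < n.+1)%N.
    by rewrite -sumn_nonzero (perm_sumn ala) sumn_parts.
  rewrite (bigD1 (BMultinom lt_a)) //= mcoeffX eqxx big1 ?addr0 // => b.
  by case/andP=> _; rewrite bmeqP mcoeffX /= => /negPf->.
rewrite big1 // => b bla; rewrite mcoeffX; case: eqP => // eq_ba.
by rewrite -eq_ba bla in nala.
Qed.

Lemma mcoeff_sym_m_part n (la mu : part n) :
  (sym_m la n)@_(mnm_part mu) = (la == mu)%:R.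
Proof.
rewrite mcoeff_sym_m nonzero_mnm_part; congr (nat_of_bool _)%:R.
by apply/idP/eqP => [/perm_parts_inj|] -> //.
Qed.

Lemma perm_mnm N (a : 'X_{1..N}) (s : 'S_N) :
  perm_eq [multinom a (s i) | i < N] a.
Proof.
apply/tuple_permP; by exists s.
Qed.

Lemma sym_m_Lambda n (la : part n) : in_Lambda n (sym_m la).
Proof.
move=> N; split.
- apply/issymP => s; apply/mpolyP => a; rewrite mcoeff_sym !mcoeff_sym_m.
congr (nat_of_bool _)%:R; apply/permPl: (parts la).
  exact/perm_filter/perm_mnm.
- apply/dhomogP=> a; rewrite mcoeff_msupp mcoeff_sym_m pnatr_eq0 eqb0 negbK.
  move=> ala; apply: etrans (esym (sumn_nonzero a)) _.
  by rewrite (perm_sumn ala) sumn_parts.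
- by apply/mpolyP=> a; rewrite mcoeff_kill_last !mcoeff_sym_m nonzero_mnmwiden.
Qed.

(** However large N is, a monomial of degree n has at most n nonzero exponents, so its coefficient
    is already visible in n variables. *)
Lemma Lambda_expand n f N : in_Lambda n f ->
  f N = \sum_(la : part n) (f n)@_(mnm_part la) *: sym_m la N.
Proof.
move=> fL; apply/mpolyP => a; rewrite raddf_sum /=.
have [deg_a|deg_a] := eqVneq (mdeg a) n; last first.
  have [_ homf _] := fL N; rewrite (dhomog_nemf_coeff homf deg_a).
  rewrite big1 // => la _; rewrite mcoeffZ mcoeff_sym_m.
  case: (boolP (perm_eq _ _)) => [/perm_sumn|]; last by rewrite mulr0.
  by rewrite sumn_nonzero sumn_parts => eq_a; rewrite eq_a eqxx in deg_a.
have [la] := exists_part_mnm a; rewrite deg_a in la * => ala.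
rewrite (bigD1 la) //= mcoeffZ mcoeff_sym_m ala mulr1 big1 ?addr0.
  by apply: Lambda_mcoeff fL _; rewrite nonzero_mnm_part.
move=> mu mu_la; rewrite mcoeffZ mcoeff_sym_m.
case: (boolP (perm_eq _ _)) => [amu|]; last by rewrite mulr0.
rewrite (@perm_parts_inj _ mu la) ?eqxx // in mu_la.
by rewrite perm_sym in amu; apply: perm_trans amu ala.
Qed.

Lemma sym_m_basis n : is_basis (@sym_m n).
Proof.
split=> [|f fL]; first exact: sym_m_Lambda.
exists [ffun la => (f n)@_(mnm_part la)]; split=> [N|c fc].
  by rewrite {1}(Lambda_expand N fL); apply: eq_bigr => la _; rewrite ffunE.
apply/ffunP => mu; rewrite ffunE fc raddf_sum (bigD1 mu) //= mcoeffZ.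
rewrite mcoeff_sym_m_part eqxx mulr1 big1 ?addr0 // => la /negPf la_mu.
by rewrite mcoeffZ mcoeff_sym_m_part la_mu mulr0.
Qed.

(** * Transition matrices *)

Lemma sum_enum_rank (T : finType) (V : nmodType) (F : 'I_#|T| -> V) :
  \sum_(x : T) F (enum_rank x) = \sum_i F i.
Proof. by rewrite [RHS](reindex _ (onW_bij _ (@enum_rank_bij T))). Qed.

Lemma eq_Lambda n f g : (forall N, f N = g N) -> in_Lambda n f -> in_Lambda n g.
Proof. by move=> eq_fg fL N; rewrite -!eq_fg; apply: fL. Qed.

Lemma Lambda_sum n (b : part n -> symfun) (c : part n -> rat) :
    (forall la, in_Lambda n (b la)) ->
  in_Lambda n (fun N => \sum_(la : part n) c la *: b la N).
Proof.
move=> bL N; split.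
- by apply: rpred_sum => la _; apply: rpredZ; case: (bL la N).
- by apply: rpred_sum => la _; apply: rpredZ; case: (bL la N).
- rewrite /kill_last raddf_sum; apply: eq_bigr => la _ /=.
  by rewrite comp_mpolyZ -/(kill_last _); case: (bL la N) => _ _ ->.
Qed.

Section Transition.

Variables (n : nat).
Implicit Types (a b c : part n -> symfun) (M : 'M[rat]_#|{: part n}|).

Lemma is_transition_Lambda a b M :
  (forall la, in_Lambda n (b la)) -> is_transition a b M ->
  forall la, in_Lambda n (a la).
Proof.
move=> bL abM la; apply: eq_Lambda (Lambda_sum _ bL) => N.
by rewrite (abM la N).
Qed.

Lemma is_transition_uniq a b M M' : is_basis b ->
  is_transition a b M -> is_transition a b M' -> M = M'.
Proof.
move=> [bL b_uniq] abM abM'; apply/matrixP=> i j.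
pose la := enum_val i; pose mu := enum_val j.
have [c [_ c_uniq]] := b_uniq (a la) (is_transition_Lambda bL abM la).
have cM X : is_transition a b X -> X i j = c mu.
  move=> abX; rewrite (c_uniq [ffun nu => X (enum_rank la) (enum_rank nu)]).
    by rewrite ffunE !enum_valK.
  by move=> N; rewrite (abX la N); apply: eq_bigr => nu _; rewrite ffunE.
by rewrite !cM.
Qed.

(** The chosen matrix is only known to satisfy the defining relation; uniqueness of coordinates in
    the basis b identifies it with M. *)
Lemma transition_eq a b M : is_basis b -> is_transition a b M ->
  transition a b = M.
Proof.
move=> b_basis abM; apply: (is_transition_uniq b_basis _ abM).
apply: (@ClassicalEpsilon.epsilon_spec _ (inhabits 0) (is_transition a b)).
by exists M.
Qed.

Lemma is_transition_comp a b c M M' : is_transition a b M ->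
  is_transition b c M' -> is_transition a c (M *m M').
Proof.
move=> abM bcM la N; rewrite (abM la N).
under eq_bigr => mu _ do rewrite (bcM mu N) scaler_sumr.
rewrite exchange_big; apply: eq_bigr => nu _; rewrite mxE scaler_suml.
rewrite -sum_enum_rank; apply: eq_bigr => mu _.
by rewrite scalerA.
Qed.

Lemma is_transition_inv a b M : is_transition a b M -> M \in unitmx ->
  is_transition b a (invmx M).
Proof.
move=> abM uM la N.
under eq_bigr => mu _ do rewrite (abM mu N) scaler_sumr.
rewrite exchange_big /= (bigD1 la) //= [X in _ + X]big1.
  rewrite addr0 -[LHS]scale1r.
  under eq_bigr => mu _ do rewrite scalerA.
  rewrite -scaler_suml; congr (_ *: _).
  have := congr1 (fun X : 'M_ _ => X (enum_rank la) (enum_rank la)) (mulVmx uM).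
  rewrite !mxE eqxx -sum_enum_rank => /esym eq1.
  by apply: etrans eq1 _; apply: eq_bigr.
move=> nu nu_la; under eq_bigr => mu _ do rewrite scalerA.
rewrite -scaler_suml.
have := congr1 (fun X : 'M_ _ => X (enum_rank la) (enum_rank nu)) (mulVmx uM).
rewrite !mxE -sum_enum_rank (inj_eq enum_rank_inj) eq_sym (negPf nu_la) => ->.
by rewrite scale0r.
Qed.

Lemma is_basis_transition a b M : is_basis b -> is_transition a b M ->
  M \in unitmx -> is_basis a.
Proof.
move=> b_basis abM uM; have [bL b_uniq] := b_basis.
split=> [|f fL]; first exact: is_transition_Lambda abM.
have [c [fc _]] := b_uniq f fL.
have baM := is_transition_inv abM uM.
exists [ffun la => \sum_mu c mu * invmx M (enum_rank mu) (enum_rank la)].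
split=> [N|c' fc'].
  rewrite (fc N); under eq_bigr => mu _ do rewrite (baM mu N) scaler_sumr.
  rewrite exchange_big; apply: eq_bigr => la _; rewrite ffunE scaler_suml.
  by apply: eq_bigr => mu _; rewrite scalerA.
have fc'M N : f N =
    \sum_mu (\sum_la c' la * M (enum_rank la) (enum_rank mu)) *: b mu N.
  rewrite (fc' N); under eq_bigr => mu _ do rewrite (abM mu N) scaler_sumr.
  rewrite exchange_big; apply: eq_bigr => la _; rewrite scaler_suml.
  by apply: eq_bigr => mu _; rewrite scalerA.
have [c1 [_ c1_uniq]] := b_uniq f fL.
have cE : c = [ffun mu => \sum_la c' la * M (enum_rank la) (enum_rank mu)].
  rewrite -(c1_uniq _ fc); apply: c1_uniq => N.
  by rewrite fc'M; apply: eq_bigr => mu _; rewrite ffunE.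
apply/ffunP => la; rewrite ffunE.
(* As row vectors the two families of coordinates satisfy c = v M, so v is recovered as c M^-1. *)
pose v : 'rV_#|{: part n}| := \row_i c' (enum_val i).
have vE mu : v 0 (enum_rank mu) = c' mu by rewrite mxE enum_rankK.
rewrite -(vE la) -[v in RHS](mulmxK uM) mxE -sum_enum_rank.
apply: eq_bigr => mu _; rewrite cE ffunE mxE -sum_enum_rank; congr (_ * _).
by apply: eq_bigr => nu _; rewrite vE.
Qed.

End Transition.

(** For a nonzero v in the left kernel, take i in its support with r i least: entry i of v M reduces
    to v_i M_ii. The rank r may have ties, so no linear order on partitions has to be chosen. *)
Lemma triangular_unitmx (F : fieldType) n (M : 'M[F]_n) (r : 'I_n -> nat) :
    (forall i, M i i != 0) ->
    (forall i j, M i j != 0 -> i = j \/ (r i < r j)%N) ->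
  M \in unitmx.
Proof.
move=> M_diag M_tri; rewrite -row_free_unit; apply: inj_row_free => v vM.
apply/rowP => j; rewrite mxE; apply/eqP/negPn/negP => vj.
case: (@arg_minnP _ j (fun i => v 0 i != 0) r vj) => i vi r_min.
have := congr1 (fun X : 'rV_n => X 0 i) vM; rewrite !mxE (bigD1 i) //=.
rewrite big1 ?addr0 => [/eqP|k k_i].
  by rewrite mulf_eq0 (negPf vi) (negPf (M_diag i)).
have [->|vk] := eqVneq (v 0 k) 0; first by rewrite mul0r.
have [->|Mki] := eqVneq (M k i) 0; first by rewrite mulr0.
case: (M_tri k i Mki) => [ki|]; first by rewrite ki eqxx in k_i.
by rewrite ltnNge r_min.
Qed.

Lemma part_diagM n (F G : part n -> rat) :
  part_diag F *m part_diag G = part_diag (fun la => F la * G la).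
Proof.
rewrite /part_diag mulmx_diag; congr diag_mx; apply/rowP => i.
by rewrite !mxE.
Qed.

Lemma part_diag_unit n (F : part n -> rat) : (forall la, F la != 0) ->
  part_diag F \in unitmx.
Proof.
move=> F_neq0; rewrite unitmxE det_diag unitfE; apply/prodf_neq0 => i _.
by rewrite mxE.
Qed.

Lemma invmx_part_diag n (F : part n -> rat) : (forall la, F la != 0) ->
  invmx (part_diag F) = part_diag (fun la => (F la)^-1).
Proof.
move=> F_neq0; apply: (can_inj (mulmxK (part_diag_unit F_neq0))).
rewrite mulVmx ?part_diag_unit // part_diagM; apply/matrixP => i j.
by rewrite !mxE mulVf.
Qed.

Definition mcoeff_mx n (a : part n -> symfun) : 'M[rat]_#|{: part n}| :=
  \matrix_(i, j) (a (enum_val i) n)@_(mnm_part (enum_val j)).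

Lemma is_transition_mcoeff n (a : part n -> symfun) :
  (forall la, in_Lambda n (a la)) -> is_transition a (@sym_m n) (mcoeff_mx a).
Proof.
move=> aL la N; rewrite {1}(Lambda_expand N (aL la)); apply: eq_bigr => mu _.
by rewrite mxE !enum_rankK.
Qed.

(** * Power sums *)

Lemma powersum_symmetric k N : powersum k N \is symmetric.
Proof.
apply/issymP => s; rewrite /powersum raddf_sum /= [RHS](reindex_inj (@perm_inj _ s)).
apply: eq_bigr => i _; rewrite rmorphXn /= msymX; congr ('X_[_] ^+ _).
by apply/mnmP=> j; rewrite mnmE !mnm1E -(inj_eq (@perm_inj _ s)) permKV.
Qed.

Lemma powersum_homog k N : powersum k N \is k.-homog.
Proof.
apply: rpred_sum => i _; rewrite mpolyXn dhomogX.
by rewrite /= mdegMn mdeg1 mul1n.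
Qed.

Lemma kill_last_powersum k N : k != 0%N ->
  kill_last (powersum k N.+1) = powersum k N.
Proof.
move=> k_neq0; rewrite /kill_last /powersum raddf_sum big_ord_recr /=.
rewrite !rmorphXn /= comp_mpolyXU -tnth_nth tnth_mktuple unlift_none /=.
rewrite expr0n (negPf k_neq0) addr0; apply: eq_bigr => i _.
by rewrite rmorphXn /= comp_mpolyXU -tnth_nth tnth_mktuple widen_ord_lift liftK.
Qed.

Lemma sym_p_Lambda n (la : part n) : in_Lambda n (sym_p la).
Proof.
move=> N; rewrite /sym_p /prod_parts; split.
- by apply: rpred_prod => k _; apply: powersum_symmetric.
- rewrite -[X in X.-homog](sumn_parts la).
  elim: (parts la) => [|k s IH]; first by rewrite big_nil; apply: dhomog1.
  by rewrite big_cons; apply: dhomogM => //; apply: powersum_homog.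
- rewrite /kill_last rmorph_prod /= !big_seq; apply: eq_bigr => k /parts_neq0.
  exact: kill_last_powersum.
Qed.

Section PowersumExpansion.

Variables (n : nat) (la : part n) (N : nat).

(* [f] distributes the factors [p_k] of [p_la] over the variables, so that the
   parts of [la] sent to the same variable are merged. *)
Definition merge_mnm (f : {ffun 'I_(len la) -> 'I_N}) : 'X_{1..N} :=
  (\sum_j U_(f j) *+ nth 0%N (parts la) j)%MM.

Lemma sym_pE : sym_p la N = \sum_f 'X_[merge_mnm f].
Proof.
rewrite /sym_p /prod_parts (big_nth 0%N) big_mkord bigA_distr_bigA /=.
apply: eq_bigr => f _; rewrite /merge_mnm -mprodXE.
by apply: eq_bigr => j _; rewrite mpolyXn.
Qed.

Lemma mcoeff_sym_p (a : 'X_{1..N}) :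
  (sym_p la N)@_a = #|[pred f | merge_mnm f == a]|%:R.
Proof.
rewrite sym_pE raddf_sum /= -sum1_card natr_sum [RHS]big_mkcond /=.
by apply: eq_bigr => f _; rewrite mcoeffX inE; case: (_ == _).
Qed.

Lemma mcoeff_sym_p_neq0 (a : 'X_{1..N}) :
  (sym_p la N)@_a != 0 <-> exists f, merge_mnm f = a.
Proof.
rewrite mcoeff_sym_p pnatr_eq0 -lt0n; split.
  by case/card_gt0P => f /eqP; exists f.
by case=> f fa; apply/card_gt0P; exists f; apply/eqP.
Qed.

Lemma merge_mnmE f i :
  merge_mnm f i = (\sum_j (f j == i) * nth 0%N (parts la) j)%N.
Proof.
by rewrite /merge_mnm mnm_sumE; apply: eq_bigr => j _; rewrite mulmnE mnm1E.
Qed.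

Definition mnm_support (a : 'X_{1..N}) := [seq i <- enum 'I_N | a i != 0%N].

Lemma nonzero_support (a : 'X_{1..N}) :
  nonzero a = [seq a i | i <- mnm_support a].
Proof.
rewrite /mnm_support -(filter_map a (predC1 0%N)); congr (nonzero _).
by rewrite -[LHS]map_tnth_enum; apply: eq_map => i; rewrite mnm_tnth.
Qed.

Lemma nth_parts_gt0 (j : 'I_(len la)) : nth 0%N (parts la) j != 0%N.
Proof. by apply: (@parts_neq0 _ la); rewrite mem_nth. Qed.

Lemma mem_support_merge f : mnm_support (merge_mnm f) =i codom f.
Proof.
move=> i; rewrite mem_filter mem_enum andbT merge_mnmE sum_nat_eq0.
apply/forallPn/codomP => [[j]|[j ->]].
  by rewrite implyTb muln_eq0 negb_or eqb0 negbK => /andP[/eqP<- _]; exists j.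
by exists j; rewrite /= eqxx mul1n nth_parts_gt0.
Qed.

Lemma perm_nonzero_merge (f : {ffun 'I_(len la) -> 'I_N}) : injective f ->
  perm_eq (nonzero (merge_mnm f)) (parts la).
Proof.
move=> f_inj; rewrite nonzero_support.
have /(perm_map (merge_mnm f))/permPl-> :
    perm_eq (mnm_support (merge_mnm f)) (codom f).
  apply: uniq_perm; last exact: mem_support_merge.
    by rewrite filter_uniq ?enum_uniq.
  exact/injectiveP.
rewrite -map_comp.
suff -> : [seq (merge_mnm f \o f) j | j <- enum 'I_(len la)] = parts la by [].
apply: (@eq_from_nth _ 0%N).
  by rewrite size_map size_enum_ord.
move=> j; rewrite size_map size_enum_ord => lt_j.
rewrite (nth_map (Ordinal lt_j)) ?size_enum_ord //=.
rewrite (nth_ord_enum _ (Ordinal lt_j)) merge_mnmE (bigD1 (Ordinal lt_j)) //=.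
rewrite eqxx mul1n big1 ?addn0 // => k; rewrite (inj_eq f_inj).
by move/negPf->.
Qed.

(** The number of nonzero exponents is the size of the image of f. If it equals [len la], then f is
    injective and no parts were merged. *)
Lemma merge_mnm_part f (mu : part n) : perm_eq (nonzero (merge_mnm f)) (parts mu) ->
  la = mu \/ (len mu < len la)%N.
Proof.
move=> f_mu; have sz_mu : #|codom f| = len mu.
  rewrite /len -(perm_size f_mu) nonzero_support size_map.
  rewrite (eq_card (fsym (mem_support_merge f))).
  by apply/card_uniqP; rewrite filter_uniq ?enum_uniq.
have := leq_image_card f 'I_(len la); rewrite sz_mu card_ord leq_eqVlt.
case/orP=> [/eqP eq_len|]; [left | by right].
have f_inj : injective f.
  have /image_injP inj : #|image f 'I_(len la)| == #|'I_(len la)|.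
    by rewrite sz_mu card_ord eq_len.
  by move=> x y; apply: inj.
apply: perm_parts_inj; rewrite perm_sym; apply: perm_trans (perm_nonzero_merge f_inj).
by rewrite perm_sym.
Qed.

End PowersumExpansion.

Lemma exists_merge_part n (la : part n) :
  exists f : {ffun 'I_(len la) -> 'I_n}, merge_mnm f = mnm_part la.
Proof.
have le_len : (len la <= n)%N.
  rewrite -{2}(sumn_parts la) size_leq_sumn //.
  by apply/negP => /parts_neq0.
pose f := [ffun j => widen_ord le_len j].
have f_inj : injective f.
  by move=> i j; rewrite !ffunE => /(congr1 val)/= /val_inj.
(* Distinct variables yield a rearrangement of la; permuting the variables turns it into x^la
   itself. *)
have := perm_nonzero_merge f_inj; rewrite -nonzero_mnm_part perm_sym.
case/mnm_permP => s ->; exists [ffun j => (s^-1)%g (f j)]; apply/mnmP=> i.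
rewrite mnmE !merge_mnmE; apply: eq_bigr => j _; rewrite [X in X == i]ffunE.
by rewrite -(inj_eq (@perm_inj _ s)) permKV.
Qed.

Lemma mcoeff_mx_p_unit n : mcoeff_mx (@sym_p n) \in unitmx.
Proof.
(* Along a row of R the length decreases away from the diagonal, so the transpose has the required
   form. *)
rewrite -unitmx_tr.
apply: (@triangular_unitmx _ _ _ (fun i => len (enum_val i))) => [i|i j].
  by rewrite !mxE; apply/mcoeff_sym_p_neq0; apply: exists_merge_part.
rewrite !mxE => /mcoeff_sym_p_neq0[f fE].
have := @merge_mnm_part _ _ _ f (enum_val i).
rewrite fE nonzero_mnm_part => /(_ (perm_refl _))[/enum_val_inj|]; last by right.
by left.
Qed.

Lemma sym_p_basis n : is_basis (@sym_p n).
Proof.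
apply: is_basis_transition (@sym_m_basis n) _ (mcoeff_mx_p_unit n).
exact/is_transition_mcoeff/sym_p_Lambda.
Qed.

(** * Newton's recursion and Cauchy's identity *)

Lemma prod_count (R : comNzRingType) n (a : nat -> R) (s : seq nat) :
    (forall k, k \in s -> (0 < k <= n)%N) ->
  \prod_(k <- s) a k = \prod_(i < n) a i.+1 ^+ count_mem i.+1 s.
Proof.
elim: s => [|k s IH] ks; first by rewrite big_nil big1.
rewrite big_cons IH => [|j js]; last by rewrite ks // inE js orbT.
under [RHS]eq_bigr => i _ do rewrite /= exprD.
rewrite big_split /=; congr (_ * _).
have /andP[k_gt0 le_kn] : (0 < k <= n)%N by rewrite ks // mem_head.
have lt_kn : (k.-1 < n)%N by rewrite prednK.
rewrite (bigD1 (Ordinal lt_kn)) //= prednK // eqxx big1 ?mulr1 // => i.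
by rewrite -val_eqE /= -eqSS prednK // eq_sym => /negPf->.
Qed.

Lemma sumn_count n (s : seq nat) : (forall k, k \in s -> (0 < k <= n)%N) ->
  sumn s = (\sum_(i < n) count_mem i.+1 s * i.+1)%N.
Proof.
elim: s => [|k s IH] ks; first by rewrite big1.
rewrite /= IH => [|j js]; last by rewrite ks // inE js orbT.
under [RHS]eq_bigr => i _ do rewrite mulnDl.
rewrite big_split; congr (_ + _)%N.
have /andP[k_gt0 le_kn] : (0 < k <= n)%N by rewrite ks // mem_head.
have lt_kn : (k.-1 < n)%N by rewrite prednK.
rewrite (bigD1 (Ordinal lt_kn)) //= prednK // eqxx mul1n big1 ?addn0 // => i.
by rewrite -val_eqE /= -eqSS prednK // eq_sym => /negPf->.
Qed.

Lemma mem_parts_bound n (la : part n) k : k \in parts la -> (0 < k <= n)%N.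
Proof.
move=> kla; rewrite lt0n (parts_neq0 kla) /=.
by rewrite -[leqRHS](sumn_parts la) leq_mem_sumn.
Qed.

(** * Logarithmic derivatives and exponentials up to degree n *)

Section Newton.

Variables (B : comNzRingType) (iota : {rmorphism rat -> B}).
Implicit Types (F G A : {poly B}) (a : nat -> B).

(* [A] agrees with [t F'(t) / F(t)] up to degree [n]. *)
Definition logder n F A := forall k, (k <= n)%N -> F`_k *+ k = (A * F)`_k.

Lemma logder1 n : logder n 1 0.
Proof. by move=> [|k] _; rewrite mul0r coef0 // coef1 mul0rn. Qed.

(** This is Leibniz' rule: in the term F_i G_(k-i) the factor k splits as i + (k - i). *)
Lemma logderM n F G A A' :
  logder n F A -> logder n G A' -> logder n (F * G) (A + A').
Proof.
move=> FA GA k le_kn; rewrite mulrDl coefD.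
rewrite (mulrA A) (mulrCA A') !coefM -sumrMnl -big_split /=.
apply: eq_bigr => i _; have le_ik : (i <= k)%N by rewrite -ltnS.
rewrite -FA ?(leq_trans le_ik) // -GA ?(leq_trans (leq_subr _ _)) //.
by rewrite mulrnAl mulrnAr -mulrnDr subnKC.
Qed.

Lemma logder_prod n (I : Type) (r : seq I) (F A : I -> {poly B}) :
  (forall i, logder n (F i) (A i)) ->
  logder n (\prod_(i <- r) F i) (\sum_(i <- r) A i).
Proof.
move=> FA; elim: r => [|i r IH]; first by rewrite !big_nil; apply: logder1.
by rewrite !big_cons; apply: logderM.
Qed.

Lemma mulrn_inj k (x y : B) : (0 < k)%N -> x *+ k = y *+ k -> x = y.
Proof.
move=> k_gt0 xy; have k1 : iota k%:R^-1 * k%:R = 1.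
  by rewrite -(rmorph_nat iota) -rmorphM mulVf ?rmorph1 ?pnatr_eq0 -?lt0n.
by rewrite -[x]mul1r -[y]mul1r -k1 -!mulrA !mulr_natl xy.
Qed.

(** Since A has no constant term, coefficient k + 1 of A F involves only the coefficients of F up to
    k. Newton's recursion then determines F, as positive integers are invertible in B. *)
Lemma logder_uniq n F G A : A`_0 = 0 -> F`_0 = G`_0 ->
  logder n F A -> logder n G A -> forall k, (k <= n)%N -> F`_k = G`_k.
Proof.
move=> A0 FG0 FA GA; elim/ltn_ind=> -[|k] IH le_kn //.
apply: (@mulrn_inj k.+1) => //; rewrite FA // GA // !coefM.
rewrite [LHS]big_ord_recl [RHS]big_ord_recl A0 !mul0r; congr (_ + _); apply: eq_bigr => i _.
rewrite IH //= /bump /= add1n subSS ?ltnS ?leq_subr //.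
exact: leq_trans (leq_subr _ _) (ltnW le_kn).
Qed.

(* The exponential of [x t^m / m], truncated; the truncation does not affect the
   coefficients up to degree [n]. *)
Definition trunc_exp n (m : nat) (x : B) : {poly B} :=
  \sum_(j < n.+1) (iota (m ^ j * j`!)%:R^-1 * x ^+ j) *: 'X^(m * j).

Lemma coef_trunc_exp n m x k : (0 < m)%N -> (k <= n)%N ->
  (trunc_exp n m x)`_k =
  if (m %| k)%N then
    iota (m ^ (k %/ m) * (k %/ m)`!)%:R^-1 * x ^+ (k %/ m)%N
  else 0.
Proof.
move=> m_gt0 le_kn; rewrite /trunc_exp coef_sum.
case: ifPn => [/dvdnP[q kE]|nmk].
  have lt_q : (q < n.+1)%N.
    by rewrite ltnS (leq_trans _ le_kn) // kE leq_pmulr.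
  rewrite (bigD1 (Ordinal lt_q)) //= big1 => [|i i_q].
    by rewrite addr0 coefZ coefXn kE mulnK // [(m * q)%N]mulnC eqxx mulr1.
  rewrite coefZ coefXn kE [(m * i)%N]mulnC eqn_pmul2r // eq_sym.
  by rewrite -[q]/(val (Ordinal lt_q)) val_eqE (negPf i_q) mulr0.
rewrite big1 // => i _; rewrite coefZ coefXn; case: eqP => [kE|]; last first.
  by rewrite mulr0.
by rewrite kE dvdn_mulr in nmk.
Qed.

Lemma logder_trunc_exp n m x : (0 < m)%N ->
  logder n (trunc_exp n m x) (x *: 'X^m).
Proof.
move=> m_gt0 k le_kn; rewrite -scalerAl coefZ coefXnM coef_trunc_exp //.
case: ltnP => [lt_km|le_mk].
  rewrite mulr0; case: ifPn => [/dvdnP[q kE]|_]; last by rewrite mul0rn.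
  move: lt_km; rewrite kE -[ltnRHS]mul1n ltn_pmul2r // ltnS leqn0 => /eqP->.
  by rewrite mul0n mulr0n.
have le_kmn : (k - m <= n)%N by rewrite (leq_trans (leq_subr _ _)).
rewrite coef_trunc_exp // dvdn_subl //; case: ifPn => [/dvdnP[q kE]|_]; last first.
  by rewrite mul0rn mulr0.
case: q kE le_mk => [|q] -> /= le_mk; first by rewrite leqNgt m_gt0 in le_mk.
(* With k = (q+1) m, the claim is that (q+1) m / (m^(q+1) (q+1)!) = 1 / (m^q q!). *)
rewrite mulSn addKn -mulSn !mulnK // mulrCA -exprS -mulrnAl; congr (_ * _).
rewrite -mulr_natr -(rmorph_nat iota) -rmorphM; congr (iota _).
rewrite expnS factS !natrM; field.
by rewrite nat1r !pnatr_eq0 -!lt0n fact_gt0 expn_gt0 m_gt0.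
Qed.

Lemma mult_leq n (la : part n) i : (mult i la <= n)%N.
Proof.
rewrite -{2}(sumn_parts la) (leq_trans (count_size _ _)) // size_leq_sumn //.
by apply/negP => /parts_neq0.
Qed.

(** Index i stands for the part i + 1. In this form a partition is a choice of one term from each of
    the n exponentials. *)
Definition mult_fun n (la : part n) : {ffun 'I_n -> 'I_n.+1} :=
  [ffun i : 'I_n => inord (mult i.+1 la)].

Lemma mult_funE n (la : part n) i : mult_fun la i = mult i.+1 la :> nat.
Proof. by rewrite ffunE inordK // ltnS mult_leq. Qed.

Lemma mult_fun_inj n : injective (@mult_fun n).
Proof.
move=> la mu eq_lm; apply/perm_parts_inj/allP => k.
rewrite mem_cat => k_lm; have /andP[k_gt0 le_kn] : (0 < k <= n)%N.
  by case/orP: k_lm; apply: mem_parts_bound.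
have lt_kn : (k.-1 < n)%N by rewrite prednK.
have := congr1 (fun f : {ffun _ -> _} => val (f (Ordinal lt_kn))) eq_lm.
by rewrite /= !mult_funE /= prednK // /mult => ->.
Qed.

Lemma mult_fun_image n : @mult_fun n @: [set: part n] =
  [set f : {ffun 'I_n -> 'I_n.+1} | (\sum_(i < n) i.+1 * f i)%N == n].
Proof.
apply/setP => f; rewrite inE; apply/imsetP/eqP => [[la _ ->]|f_n].
  rewrite -[RHS](sumn_parts la) (sumn_count (@mem_parts_bound _ la)).
  by apply: eq_bigr => i _; rewrite mult_funE mulnC.
pose s := flatten [seq nseq (f i) i.+1 | i <- enum 'I_n].
have s_count (i : nat) : count_mem i.+1 s = (\sum_(j < n) (val j == i) * f j)%N.
  rewrite count_flatten -map_comp sumnE big_map big_enum /=.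
  by apply: eq_bigr => j _; rewrite count_nseq /= eqSS.
have [||la la_s] := @exists_part n s.
- apply/negP => /flattenP[_ /mapP[i _ ->]].
  by rewrite mem_nseq => /andP[].
- rewrite -f_n sumnE big_flatten big_map big_enum /=.
  by apply: eq_bigr => i _; rewrite big_nseq iter_addn_0.
exists la => //; apply/ffunP => i; apply: val_inj; rewrite /= mult_funE /mult.
rewrite (seq.permP la_s) s_count (bigD1 i) //= eqxx mul1n big1 ?addn0 // => j.
by rewrite -val_eqE => /negPf /= ->.
Qed.

(** Taking term n_m of the m-th exponential contributes t^(m n_m) with denominator m^(n_m) n_m!. The
    choices of total degree n are the partitions of n, and their denominators multiply to z. *)
Lemma coef_prod_trunc_exp n a :
  (\prod_(m < n) trunc_exp n m.+1 (a m.+1))`_n =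
  \sum_(la : part n) iota (zval la)^-1 * \prod_(k <- parts la) a k.
Proof.
rewrite /trunc_exp bigA_distr_bigA coef_sum.
under eq_bigr => f _ do rewrite scaler_prod prodrXr coefZ coefXn eq_sym.
rewrite (bigID (fun f : {ffun 'I_n -> 'I_n.+1} => (\sum_(i < n) i.+1 * f i)%N == n)) /=.
rewrite [X in _ + X]big1 ?addr0 => [|f /negPf ->]; last by rewrite mulr0.
under eq_bigr => f -> do rewrite mulr1.
rewrite -big_set -mult_fun_image big_imset; last first.
  by move=> ? ? _ _; apply: mult_fun_inj.
apply: eq_big => [la|la _]; first by rewrite inE.
rewrite (prod_count a (@mem_parts_bound _ la)) big_split /= -rmorph_prod.
congr (iota _ * _); last by apply: eq_bigr => i _; rewrite mult_funE.
rewrite /zval big_add1 big_mkord /= natr_prod prodfV.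
by congr (_^-1); apply: eq_bigr => i _; rewrite mult_funE.
Qed.

End Newton.

(* The coefficients of [t F'(t) / F(t)] for [F = 1 + t + ... + t^d]. *)
Definition geom_logder (R : comNzRingType) d m : R :=
  if m == 0%N then 0 else if (d.+1 %| m)%N then - d%:R else 1.

(** Every d + 1 consecutive coefficients consist of d ones and one -d, so the partial sums climb
    from 0 to d and fall back to 0. *)
Lemma sum_geom_logder (R : comNzRingType) d k :
  \sum_(i < k.+1) geom_logder R d i = (k %% d.+1)%:R.
Proof.
elim: k => [|k IH]; first by rewrite big_ord1 mod0n.
rewrite big_ord_recr /= IH /geom_logder /= modnS.
case: ifPn => [dvd_k|_]; last by rewrite natr1.
suff -> : (k %% d.+1 = d)%N by rewrite subrr.
apply/eqP; rewrite -eqSS eqn_leq ltn_pmod //= dvdn_leq //.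
move: dvd_k; rewrite {1}(divn_eq k d.+1) -addnS dvdn_addr //.
exact: dvdn_mull.
Qed.

(** Multiplying by 1 + t + ... + t^d sums the coefficients over a window of length d + 1. For k > d
    the window is a full period, with sum 0; for k <= d it reaches back to 0 and has sum k. *)
Lemma sum_geom_logder_window (R : comNzRingType) d k :
  \sum_(i < k.+1) geom_logder R d i * (k - i <= d)%N%:R = (k * (k <= d))%N%:R.
Proof.
case: leqP => [le_kd|lt_dk].
  rewrite muln1 -[k in RHS](@modn_small k d.+1) // -sum_geom_logder.
  apply: eq_bigr => i _; rewrite (leq_trans (leq_subr _ _) le_kd) mulr1.
  by [].
rewrite muln0 -(big_mkord xpredT (fun i => geom_logder R d i * (k - i <= d)%N%:R)).
rewrite (@big_cat_nat _ _ _ (k - d)) //=; last by rewrite leqW ?leq_subr.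
rewrite big_nat_cond big1 ?add0r => [|i /andP[/andP[_ lt_i] _]]; last first.
  by rewrite leqNgt ltn_subRL addnC -ltn_subRL lt_i mulr0.
transitivity (\sum_(k - d <= i < k.+1) geom_logder R d i).
  apply: eq_big_nat => i /andP[le_i _].
  by rewrite leq_subCl le_i mulr1.
have k_mod : ((k - d).-1 %% d.+1 = k %% d.+1)%N.
  by rewrite -subnS -[in RHS](subnK lt_dk) modnDr.
have := sum_geom_logder R d k.
rewrite -(big_mkord xpredT (geom_logder R d)) (@big_cat_nat _ _ _ (k - d)) //=.
  rewrite -(prednK (_ : 0 < k - d)%N) ?subn_gt0 // big_mkord sum_geom_logder.
  rewrite prednK ?subn_gt0 // k_mod.
  by move/(canRL (addKr _)) ->; rewrite addNr.
by rewrite leqW ?leq_subr.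
Qed.

Definition geom (R : comNzRingType) d (x : R) := \poly_(j < d.+1) x ^+ j.

Lemma logder_geom (R : comNzRingType) d n (x : R) :
  logder n (geom d x) (\poly_(m < n.+1) (geom_logder R d m * x ^+ m)).
Proof.
move=> k le_kn; rewrite coefM coef_poly ltnS.
transitivity (\sum_(i < k.+1) geom_logder R d i * (k - i <= d)%N%:R * x ^+ k).
  rewrite -mulr_suml sum_geom_logder_window mulr_natl mulnC mulrnA.
  by case: leqP; rewrite ?mul0rn.
apply: eq_bigr => i _; have le_ik : (i <= k)%N by rewrite -ltnS.
rewrite !coef_poly ltnS (leq_trans le_ik le_kn) ltnS.
case: leqP => _; last by rewrite !mulr0 mul0r.
by rewrite mulr1 -mulrA -exprD subnKC.
Qed.

Lemma count_dvdn n d (s : seq nat) : (forall k, k \in s -> (0 < k <= n)%N) ->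
  (\sum_(1 <= k < n.+1) count_mem (k * d.+1)%N s)%N = count (dvdn d.+1) s.
Proof.
elim: s => [|x s IH] xs; first by rewrite big1.
rewrite big_split /= IH => [|j js]; last by rewrite xs // inE js orbT.
congr (_ + _)%N; have /andP[x_gt0 le_xn] : (0 < x <= n)%N by rewrite xs // mem_head.
case: (boolP (d.+1 %| x)%N) => [/dvdnP[q xq]|ndx].
  have q_gt0 : (0 < q)%N by move: x_gt0; rewrite xq muln_gt0 => /andP[].
  have le_qn : (q < n.+1)%N by rewrite ltnS (leq_trans _ le_xn) // xq leq_pmulr.
  rewrite (big_rem q) ?mem_index_iota ?q_gt0 //= -xq eqxx big_seq big1 // => k.
  rewrite mem_rem_uniq ?iota_uniq // inE => /andP[/negPf k_q _].
  by rewrite xq eqn_pmul2r // eq_sym k_q.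
rewrite big1 // => k _; case: eqP => // xk.
by rewrite xk dvdn_mull in ndx.
Qed.

Lemma Dval_count d n (la : part n) :
  Dval d la = (- d%:R) ^+ count (dvdn d.+1) (parts la).
Proof. by rewrite /Dval count_dvdn //; apply: mem_parts_bound. Qed.

Lemma prod_geom_logder (R : comNzRingType) d n (la : part n) :
  \prod_(k <- parts la) geom_logder R d k = (- d%:R) ^+ count (dvdn d.+1) (parts la).
Proof.
have: {in parts la, forall k, k != 0%N} by move=> k; apply: parts_neq0.
elim: (parts la) => [|k s IH] ks; first by rewrite big_nil.
rewrite big_cons IH => [|j js]; last by rewrite ks // inE js orbT.
rewrite /= exprD /geom_logder (negPf (ks k _)) ?mem_head //.
by case: ifP; rewrite ?expr1 ?expr0.
Qed.

(** Put a_m = [geom_logder B d m] times the m-th power sum of the w_i. The product of geometric sums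
    and the product of the exponentials of a_m t^m / m have constant term 1 and, up to degree n, the
    same logarithmic derivative, hence the same coefficient at n. *)
Lemma coef_prod_geom (B : comNzRingType) (iota : {rmorphism rat -> B})
    (I : finType) (w : I -> B) d n :
  (\prod_i geom d (w i))`_n =
  \sum_(la : part n) iota (Dval d la / zval la) *
    \prod_(k <- parts la) \sum_i w i ^+ k.
Proof.
pose a k := geom_logder B d k * \sum_i w i ^+ k.
transitivity (\prod_(m < n) trunc_exp iota n m.+1 (a m.+1))`_n.
  pose A := \sum_(i : I) \poly_(m < n.+1) (geom_logder B d m * w i ^+ m).
  apply: (@logder_uniq _ iota n _ _ A _ _ _ _ n (leqnn n)).
  - by rewrite coef_sum big1 // => i _; rewrite coef_poly mul0r.
  - rewrite !coef0_prod !big1 // => i _; last by rewrite coef_poly.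
    by rewrite coef_trunc_exp // div0n dvdn0 mul1n invr1 rmorph1 mul1r.
  - by apply: logder_prod => i; apply: logder_geom.
  - have -> : A = \sum_(m < n) a m.+1 *: 'X^(m.+1).
      apply/polyP=> k; rewrite /A !coef_sum.
      transitivity ((k < n.+1)%:R * a k).
        under eq_bigr => i _ do rewrite coef_poly.
        case: ltnP => _; last by rewrite big1 ?mul0r.
        by rewrite mul1r /a mulr_sumr.
      case: k => [|k]; first rewrite /a mul0r mulr0 big1 // => i _.
        by rewrite coefZ coefXn mulr0.
      rewrite ltnS; case: ltnP => [lt_kn|le_nk].
        rewrite (bigD1 (Ordinal lt_kn)) //= coefZ coefXn eqxx mulr1 mul1r.
        rewrite big1 ?addr0 // => i; rewrite -val_eqE /= => /negPf i_k.
        by rewrite coefZ coefXn eqSS eq_sym i_k mulr0.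
      rewrite mul0r big1 // => i _; rewrite coefZ coefXn eqSS.
      by rewrite gtn_eqF ?mulr0 // (leq_trans (ltn_ord i)).
    by apply: logder_prod => m; apply: logder_trunc_exp.
rewrite coef_prod_trunc_exp; apply: eq_bigr => la _.
rewrite big_split /= mulrA prod_geom_logder Dval_count mulrC.
rewrite rmorphM rmorphXn rmorphN rmorph_nat mulrC; congr (_ * _).
by rewrite mulrC.
Qed.

Lemma coef_comp_polyZX (R : comNzRingType) (p : {poly R}) (c : R) k :
  (p \Po (c *: 'X))`_k = p`_k * c ^+ k.
Proof.
rewrite comp_polyE coef_sum.
under eq_bigr => i _ do rewrite exprZn !coefZ coefXn.
case: (ltnP k (size p)) => [lt_k|le_k].
  rewrite (bigD1 (Ordinal lt_k)) //= eqxx mulr1 big1 ?addr0 // => i.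
  by rewrite -val_eqE eq_sym /= => /negPf->; rewrite !mulr0.
rewrite nth_default // mul0r big1 // => i _.
by rewrite gtn_eqF ?mulr0 // (leq_trans (ltn_ord i)).
Qed.

(** Multiplying every x_i by c amounts to substituting c t for t. *)
Lemma coef_prod_geom_scale (R S : comNzRingType) (phi : {rmorphism R -> S})
    (I : finType) (x : I -> R) (c : S) d k :
  (\prod_i geom d (phi (x i) * c))`_k =
  phi (\prod_i geom d (x i))`_k * c ^+ k.
Proof.
have geomE y : geom d (phi y * c) = map_poly phi (geom d y) \Po (c *: 'X).
  apply/polyP => j; rewrite coef_comp_polyZX coef_map !coef_poly.
  case: ltnP => _; first by rewrite /= exprMn rmorphXn.
  by rewrite raddf0 mul0r.
under eq_bigr => i _ do rewrite geomE.
by rewrite -coef_map -coef_comp_polyZX !rmorph_prod.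
Qed.

(* Cauchy's identity for [truncated d], read off at the monomial [y^la]. *)
Lemma sym_hd_sym_p d n (la : part n) N :
  sym_hd d la N = \sum_(mu : part n)
    ((sym_p mu n)@_(mnm_part la) * (Dval d mu / zval mu)) *: sym_p mu N.
Proof.
pose iota := mpolyC n (R := {mpoly rat[N]}) \o mpolyC N (R := rat).
(* The y_j are the outer variables and the x_i lie in the coefficient ring, so extracting the
   coefficient of y^la leaves a polynomial in x. *)
pose w (ji : 'I_n * 'I_N) : {mpoly {mpoly rat[N]}[n]} := ('X_(ji.2))%:MP * 'X_(ji.1).
have := congr1 (mcoeff (mnm_part la)) (coef_prod_geom iota w d n).
have -> : \prod_ji geom d (w ji) =
    \prod_j \prod_i geom d (('X_i)%:MP * 'X_j : {mpoly {mpoly rat[N]}[n]}).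
  by rewrite pair_big.
pose P : {poly {mpoly rat[N]}} := \prod_i geom d 'X_i.
(* S is at least the size of P, so the expansion is complete, and it exceeds n, so every row length
   of la is an admissible index. *)
pose S := maxn (size P) n.+1.
have QE (j : 'I_n) :
    \prod_i geom d (('X_i)%:MP * 'X_j : {mpoly {mpoly rat[N]}[n]}) =
    \sum_(k < S) ((P`_k)%:MP * 'X_j ^+ k) *: 'X^k.
  rewrite -(poly_def S (fun k => (P`_k)%:MP * 'X_j ^+ k)).
  apply/polyP => k; rewrite (coef_prod_geom_scale (mpolyC n (R := _))).
  rewrite coef_poly; case: ltnP => // le_Sk.
  by rewrite nth_default ?mpolyC0 ?mul0r // (leq_trans (leq_maxl _ _) le_Sk).
under eq_bigr => j _ do rewrite QE.
rewrite bigA_distr_bigA coef_sum raddf_sum /=.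
have lt_S (j : 'I_n) : (row_len la j < S)%N by rewrite leq_max ltn_ord orbT.
pose f0 : {ffun 'I_n -> 'I_S} := [ffun j => Ordinal (lt_S j)].
have termE (f : {ffun 'I_n -> 'I_S}) :
    (\prod_j (((P`_(f j))%:MP * 'X_j ^+ f j) *: 'X^(f j)))`_n@_(mnm_part la) =
    (\prod_j P`_(f j)) * ([multinom val (f j) | j < n] == mnm_part la)%:R
      *+ (n == \sum_j f j)%N.
  rewrite scaler_prod prodrXr coefZ coefXn mulr_natr mcoeffMn; congr (_ *+ _).
  rewrite big_split /= -rmorph_prod mcoeffCM -mcoeffX; congr (_ * _@__).
  by rewrite mpolyXE_id; apply: eq_bigr => j _; rewrite mnmE.
have mnm_f0 : [multinom val (f0 j) | j < n] = mnm_part la.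
  by apply/mnmP => j; rewrite !mnmE ffunE.
(* The exponent of y_j is the power of t taken from the j-th factor, so f0 is the only choice
   producing y^la. *)
rewrite (bigD1 f0) //= [X in _ + X]big1 => [|f f_neq]; last first.
  rewrite termE; case: eqP => [f_la|_]; last by rewrite mulr0 mul0rn.
  case/eqP: f_neq; apply/ffunP => j; apply: val_inj => /=.
  by rewrite ffunE -[LHS](mnmE (fun j => val (f j))) f_la mnmE.
(* The zero rows, absent from [parts la], contribute the constant term of P, which is 1. *)
have -> : sym_hd d la N = \prod_j P`_(row_len la j).
  rewrite /sym_hd /prod_parts big_filter big_map big_tuple big_mkcond.
  apply: eq_bigr => j _ /=; case: eqP => [j0|] //.
  rewrite /row_len j0 /P coef0_prod big1 // => i _.
  by rewrite coef_poly.
have sum_f0 : (\sum_j f0 j = n)%N.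
  rewrite -[RHS](mdeg_mnm_part la) mdegE; apply: eq_bigr => j _.
  by rewrite ffunE mnmE.
rewrite termE mnm_f0 sum_f0 !eqxx mulr1 mulr1n addr0.
under eq_bigr => j _ do rewrite ffunE.
move=> ->; rewrite raddf_sum; apply: eq_bigr => mu _.
have pE : \prod_(k <- parts mu) \sum_ji w ji ^+ k =
    (sym_p mu N)%:MP * map_mpoly (mpolyC N (R := rat)) (sym_p mu n).
  rewrite /sym_p /prod_parts !rmorph_prod -big_split; apply: eq_bigr => k _ /=.
  rewrite /powersum !raddf_sum mulr_suml.
  rewrite -(pair_bigA _ (fun j i => w (j, i) ^+ k)) exchange_big.
  apply: eq_bigr => i _ /=; rewrite mulr_sumr; apply: eq_bigr => j _.
  by rewrite /w exprMn !rmorphXn /= map_mpolyX.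
rewrite pE /= !mcoeffCM mcoeff_map_mpoly /=.
by rewrite mulrCA mulrC -mpolyCM mul_mpolyC [(Dval _ _ / _ * _)]mulrC.
Qed.

(** Each variable contributes one power of exponent at most d. The comparisons with e (d = 1) and h
    (k <= d) become comparisons of coefficients. *)
Lemma mcoeff_truncated d k N (a : 'X_{1..N}) :
  (truncated d k N)@_a = ((mdeg a == k) && [forall i, (a i <= d)%N])%:R.
Proof.
rewrite /truncated; under eq_bigr => i _ do rewrite poly_def.
rewrite bigA_distr_bigA coef_sum raddf_sum /=.
have termE (f : {ffun 'I_N -> 'I_d.+1}) :
    (\prod_i ('X_i ^+ f i *: 'X^(f i) : {poly {mpoly rat[N]}}))`_k@_a =
    ([multinom val (f i) | i < N] == a)%:R *+ (k == mdeg a).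
  rewrite scaler_prod prodrXr coefZ coefXn mulr_natr mcoeffMn.
  have -> : \prod_i 'X_i ^+ f i = 'X_[rat, [multinom val (f i) | i < N]].
    by rewrite mpolyXE_id; apply: eq_bigr => i _; rewrite mnmE.
  rewrite mcoeffX; case: eqP => [<-|_]; last by rewrite !mul0rn.
  by congr (_ *+ (_ == _)); rewrite mdegE; apply: eq_bigr => i _; rewrite mnmE.
under eq_bigr => f _ do rewrite termE.
case: (boolP [forall i, _]) => [/forallP a_d|/forallPn[i a_i]]; last first.
  rewrite andbF big1 // => f _; case: eqP => [fa|]; last by rewrite mul0rn.
  by case/negP: a_i; rewrite -fa mnmE -ltnS ltn_ord.
pose f0 : {ffun 'I_N -> 'I_d.+1} := [ffun i => inord (a i)].
have f0E : [multinom val (f0 i) | i < N] = a.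
  by apply/mnmP=> i; rewrite mnmE ffunE /= inordK // ltnS.
rewrite andbT (bigD1 f0) //= f0E eqxx big1 => [|f f_neq].
  by rewrite addr0 eq_sym; case: (_ == _).
case: eqP => [fa|]; last by rewrite mul0rn.
case/eqP: f_neq; apply/ffunP => i; apply: val_inj => /=.
by rewrite ffunE -fa mnmE inord_val.
Qed.

Lemma truncated1 k N : truncated 1 k N = elementary k N.
Proof. by apply/mpolyP => a; rewrite mcoeff_truncated mcoeff_mesym. Qed.

Lemma truncated_complete d k N : (k <= d)%N -> truncated d k N = complete k N.
Proof.
move=> le_kd; apply/mpolyP => a; rewrite mcoeff_truncated /complete raddf_sum /=.
case: eqP => [ak|ak]; last first.
  rewrite big1 // => b /eqP bk; rewrite mcoeffX; case: eqP => // ba.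
  by case: ak; rewrite -ba.
have lt_a : (mdeg a < k.+1)%N by rewrite ak.
rewrite (bigD1 (BMultinom lt_a)) ?ak //= mcoeffX eqxx big1 ?addr0 => [|b].
  have -> // : [forall i, (a i <= d)%N].
  apply/forallP => i; apply: leq_trans le_kd.
  by rewrite -ak mdegE (bigD1 i) //= leq_addr.
by case/andP=> _; rewrite bmeqP mcoeffX => /negPf->.
Qed.

Lemma sym_hd1 n (la : part n) N : sym_hd 1 la N = sym_e la N.
Proof. by apply: eq_bigr => k _; apply: truncated1. Qed.

Lemma sym_hdn n (la : part n) N : sym_hd n la N = sym_h la N.
Proof.
rewrite /sym_hd /sym_h /prod_parts !big_seq; apply: eq_bigr => k k_la.
by apply: truncated_complete; case/andP: (mem_parts_bound k_la).
Qed.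

Lemma count_dvdn_large n (la : part n) : count (dvdn n.+1) (parts la) = 0%N.
Proof.
apply/eqP; rewrite -leqn0 leqNgt -has_count; apply/hasPn => k.
by case/mem_parts_bound/andP=> k_gt0 le_kn; rewrite gtnNdvd.
Qed.

Lemma Dval_large n (la : part n) : Dval n la = 1.
Proof. by rewrite Dval_count count_dvdn_large. Qed.

(** Here n - [len la] is the sum of k - 1 over the parts k; modulo 2 it counts the even parts, which
    are those divisible by d + 1 = 2. *)
Lemma Dval1 n (la : part n) : Dval 1 la = epsval la.
Proof.
rewrite Dval_count /epsval /len -(signr_odd _ (n - _)) -(signr_odd _ (count _ _)).
congr (_ ^+ nat_of_bool _); rewrite -[X in (X - _)%N](sumn_parts la).
elim: (parts la) (@parts_neq0 _ la) => //= k s IH ks.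
have k_gt0 : (0 < k)%N by rewrite lt0n ks ?mem_head.
have s_gt0 j : j \in s -> (0 < j)%N.
  by move=> js; rewrite lt0n ks // inE js orbT.
have le_s : (size s <= sumn s)%N.
  by rewrite size_leq_sumn //; apply/negP => /s_gt0.
rewrite -(prednK k_gt0) addSn subSS -addnBA // !oddD IH => [|j js]; last first.
  by rewrite -lt0n s_gt0.
by rewrite dvdn2 /= negbK oddb.
Qed.

Lemma Dval_neq0 d n (la : part n) : (0 < d)%N -> Dval d la != 0.
Proof. by move=> d_gt0; rewrite expf_neq0 // oppr_eq0 pnatr_eq0 -lt0n. Qed.

Lemma zval_neq0 n (la : part n) : zval la != 0.
Proof.
rewrite /zval pnatr_eq0 -lt0n big_seq prodn_cond_gt0 // => i.
by rewrite mem_index_iota => /andP[i_gt0 _]; rewrite muln_gt0 expn_gt0 i_gt0 fact_gt0.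
Qed.

(** * Schur functions *)

Lemma card_ord_ltn n m : (m <= n)%N -> #|[set i : 'I_n | (i < m)%N]| = m.
Proof.
move=> le_mn; rewrite -sum1_card (eq_bigl (fun i : 'I_n => (i < m)%N)) => [|i].
  by rewrite -(big_ord_widen n (fun=> 1%N)) // sum1_card card_ord.
by rewrite inE.
Qed.

(** It turns cardinalities into inequalities, in both directions of the passage between tableaux and
    patterns. *)
Lemma mem_initial_segment n (S : {set 'I_n}) :
    (forall i j : 'I_n, j \in S -> (i <= j)%N -> i \in S) ->
  forall j : 'I_n, (j \in S) = (j < #|S|)%N.
Proof.
move=> S_down j; apply/idP/idP => [jS|].
  rewrite -[X in (X <= _)%N](card_ord_ltn (ltn_ord j)) subset_leq_card //.
  by apply/subsetP => i; rewrite inE ltnS; apply: S_down.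
apply: contraLR => njS; rewrite -leqNgt -[leqRHS](card_ord_ltn (ltnW (ltn_ord j))).
apply: subset_leq_card; apply/subsetP => i iS; rewrite inE ltnNge.
by apply: contra njS; apply: S_down.
Qed.

Section Tableaux.

Variables (n : nat) (la : part n).

(** Row lengths extended by 0 to all natural indices, so that the row below the last one makes
    sense. *)
Definition shape (i : nat) : nat := nth 0%N (map val (val la)) i.

Lemma shapeE (i : 'I_n) : shape i = row_len la i.
Proof. by rewrite /shape (nth_map ord0) ?size_tuple // -tnth_nth. Qed.

Lemma shape_default i : (n <= i)%N -> shape i = 0%N.
Proof. by move=> le_ni; rewrite /shape nth_default // size_map size_tuple. Qed.

Lemma shape_leq i : (shape i <= n)%N.
Proof.
have [lt_in|/shape_default->//] := ltnP i n.
by rewrite -[i]/(val (Ordinal lt_in)) shapeE -ltnS ltn_ord.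
Qed.

Lemma shape_decr i : (shape i.+1 <= shape i)%N.
Proof.
have [lt_in|/shape_default->//] := ltnP i.+1 n.
have /andP[la_sorted _] := valP la.
have geq_trans : transitive geq by move=> a b c /= ba cb; apply: leq_trans cb ba.
have sz : size (map val (val la)) = n by rewrite size_map size_tuple.
apply: (sorted_ltn_nth geq_trans 0%N la_sorted); rewrite ?inE ?sz //.
exact: ltnW.
Qed.

Lemma sum_shape : (\sum_(i < n) shape i = n)%N.
Proof.
have /andP[_ /eqP sum_la] := valP la.
rewrite -[RHS]sum_la sumnE big_map big_tuple; apply: eq_bigr => i _.
exact: shapeE.
Qed.

Lemma cell_ltn (c : cell la) : ((val c).2 < shape (val c).1)%N.
Proof. by rewrite shapeE; apply: (valP c). Qed.

Lemma exists_cell (i : nat) (j : 'I_n) : (j < shape i)%N ->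
  exists c : cell la, (val c).1 = i :> nat /\ (val c).2 = j.
Proof.
move=> lt_j; have lt_in : (i < n)%N.
  by rewrite ltnNge; apply: contraTN lt_j => /shape_default->; rewrite ltn0.
have c_cell : is_cell la (Ordinal lt_in, j) by rewrite /is_cell /= -shapeE.
by exists (Sub (Ordinal lt_in, j) c_cell); rewrite SubK.
Qed.

Lemma cell_inj (c c' : cell la) : (val c).1 = (val c').1 :> nat ->
  (val c).2 = (val c').2 :> nat -> c = c'.
Proof.
move=> eq1 eq2; apply: val_inj; move: eq1 eq2.
by case: (val c) (val c') => [i j] [i' j'] /= /val_inj -> /val_inj ->.
Qed.

Section Counting.

Variable N : nat.
Implicit Types T : {ffun cell la -> 'I_N}.

Lemma semistandard_row T (c c' : cell la) : semistandard T ->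
  (val c).1 = (val c').1 -> ((val c).2 <= (val c').2)%N -> (T c <= T c')%N.
Proof.
move=> /forallP/(_ c)/forallP/(_ c')/andP[/implyP sst _] eq1.
rewrite leq_eqVlt => /orP[/eqP eq2|lt2].
  by rewrite (@cell_inj c c') ?eq1.
by apply: sst; rewrite eq1 eqxx.
Qed.

Lemma semistandard_col T (c c' : cell la) : semistandard T ->
  (val c).2 = (val c').2 -> ((val c).1 < (val c').1)%N -> (T c < T c')%N.
Proof.
move=> /forallP/(_ c)/forallP/(_ c')/andP[_ /implyP sst] eq2 lt1.
by apply: sst; rewrite eq2 eqxx.
Qed.

Definition row_count T (i k : nat) : nat :=
  #|[set c : cell la | ((val c).1 == i :> nat) && (T c < k)%N]|.

Lemma row_count_cols T i k : row_count T i k =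
  #|[set (val c).2 |
       c in [set c : cell la | ((val c).1 == i :> nat) && (T c < k)%N]]|.
Proof.
rewrite card_in_imset // => c1 c2.
rewrite !inE => /andP[/eqP row1 _] /andP[/eqP row2 _] eq2.
by apply: cell_inj; rewrite ?eq2 // row1 row2.
Qed.

(** Rows increase weakly, so the cells of a row with entries below k fill an initial segment of its
    columns. A tableau is therefore determined by its counts. *)
Lemma ltn_row_count T (c : cell la) k : semistandard T ->
  (T c < k)%N = ((val c).2 < row_count T (val c).1 k)%N.
Proof.
move=> sst; rewrite row_count_cols -mem_initial_segment => [|i _ /imsetP[c1 c1A ->] le_i].
  apply/idP/imsetP => [Tc|[c' c'A eq2]].
    by exists c; rewrite // inE eqxx.
  move: c'A; rewrite inE => /andP[/eqP eq1 Tc'].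
  by rewrite (@cell_inj c c') ?eq1 ?eq2.
move: c1A; rewrite inE => /andP[/eqP eq1 Tc1].
have [|c2 [row2 col2]] := @exists_cell (val c).1 i.
  by rewrite -eq1 (leq_ltn_trans le_i) ?cell_ltn.
apply/imsetP; exists c2; rewrite ?col2 // inE row2 eqxx /=.
apply: leq_ltn_trans Tc1; apply: semistandard_row => //; last by rewrite col2.
by apply: val_inj; rewrite /= row2 eq1.
Qed.

End Counting.

End Tableaux.

(** * Gelfand-Tsetlin patterns *)

Section Interlacing.

Variables (n : nat) (la : part n).

(* A tableau with entries below [N] is encoded by the array [g], where [g i k]
   counts the entries of row [i] that are smaller than [k]; this is a
   Gelfand-Tsetlin pattern. *)
Definition interlacing N (g : nat -> nat -> nat) : Prop :=
  [/\ forall i, g i 0%N = 0%N, forall i, g i N = shape la i,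
      forall i k, (k < N)%N -> (g i k <= g i k.+1)%N
    & forall i k, (k < N)%N -> (g i.+1 k.+1 <= g i k)%N].

Lemma row_count_interlacing N (T : {ffun cell la -> 'I_N}) :
  semistandard T -> interlacing N (row_count T).
Proof.
move=> sst; split=> [i|i|i k _|i k _].
- by apply/eqP; rewrite cards_eq0; apply/eqP/setP => c; rewrite !inE andbF.
- rewrite row_count_cols -[RHS](card_ord_ltn (shape_leq la i)).
  apply: eq_card => j; rewrite inE; apply/imsetP/idP => [[c]|].
    by rewrite inE => /andP[/eqP <- _] ->; apply: cell_ltn.
  by case/exists_cell=> c [ci <-]; exists c; rewrite // inE ci eqxx /=.
- apply/subset_leq_card/subsetP => c; rewrite !inE => /andP[-> /=].
  by move/ltnW; rewrite ltnS.
(* Column strictness: directly above a cell with entry below k + 1 stands one with entry below k. *)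
- rewrite !row_count_cols.
  apply/subset_leq_card/subsetP => j /imsetP[c]; rewrite inE => /andP[/eqP ci Tc] ->.
  have [|c' [c'i eq2]] := @exists_cell _ la i (val c).2.
    by apply: leq_trans (shape_decr la i); rewrite -ci cell_ltn.
  apply/imsetP; exists c'; rewrite // inE c'i eqxx /=.
  have lt_T : (T c' < T c)%N by apply: semistandard_col; rewrite // c'i ci.
  exact: leq_trans lt_T Tc.
Qed.

Variable N : nat.
Implicit Types (T : {ffun cell la -> 'I_N.+1}) (g : nat -> nat -> nat).

(** The inverse of [row_count]: an entry in column j is the number of k in 1, ..., N with g i k <=
    j, the index k standing for k + 1. The value N + 1 never qualifies, as the column lies inside
    the row. *)
Definition tableau_of g : {ffun cell la -> 'I_N.+1} :=
  [ffun c : cell la =>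
     inord #|[set k : 'I_N | (g (val c).1 k.+1 <= (val c).2)%N]| : 'I_N.+1].

Lemma interlacing_mono g i k l : interlacing N.+1 g ->
  (k <= l)%N -> (l <= N.+1)%N -> (g i k <= g i l)%N.
Proof.
case=> _ _ g_mono _; elim: l => [|l IH]; first by rewrite leqn0 => /eqP->.
rewrite leq_eqVlt => /orP[/eqP-> //|le_kl] le_lN.
by rewrite (leq_trans (IH _ _)) ?g_mono // ltnW.
Qed.

Lemma interlacing_anti g i j k : interlacing N.+1 g ->
  (i <= j)%N -> (k <= N.+1)%N -> (g j k <= g i k)%N.
Proof.
move=> gI le_ij; have [g0 _ _ g_col] := gI.
elim: j le_ij k => [|j IH]; first by rewrite leqn0 => /eqP->.
rewrite leq_eqVlt => /orP[/eqP-> //|/IH le_ij] k le_kN.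
apply: leq_trans (le_ij k le_kN); case: k le_kN => [|k] le_kN.
  by rewrite !g0.
by rewrite (leq_trans (g_col _ _ _)) // (interlacing_mono _ gI).
Qed.

(** By monotonicity the qualifying values of k form an initial segment, so there are at least k of
    them exactly when k qualifies. The ends 0 and N + 1 follow from the boundary values of g. *)
Lemma leq_tableau_of g (c : cell la) k : interlacing N.+1 g -> (k <= N.+1)%N ->
  (k <= tableau_of g c)%N = (g (val c).1 k <= (val c).2)%N.
Proof.
move=> gI; have [g0 gN _ _] := gI; rewrite ffunE.
set S := [set _ | _]; have le_S : (#|S| <= N)%N.
  by rewrite -[leqRHS]card_ord max_card.
rewrite inordK ?ltnS //; case: k => [|k]; first by rewrite g0.
rewrite ltnS leq_eqVlt => /orP[/eqP->|lt_kN].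
  by rewrite gN [in RHS]leqNgt cell_ltn ltnNge le_S.
rewrite -[k]/(val (Ordinal lt_kN)) -mem_initial_segment; first by rewrite inE.
move=> i j; rewrite !inE => le_g le_ij; apply: leq_trans le_g.
by apply: interlacing_mono => //; apply: ltnW (ltn_ord j).
Qed.

Lemma tableau_of_semistandard g : interlacing N.+1 g ->
  semistandard (tableau_of g).
Proof.
move=> gI; have [_ gN _ g_col] := gI; apply/forallP => c; apply/forallP => c'.
have le_T : (g (val c).1 (tableau_of g c) <= (val c).2)%N.
  by rewrite -leq_tableau_of // ltnW.
apply/andP; split; apply/implyP => /andP[/eqP eq_c lt_c].
  rewrite leq_tableau_of // -?eq_c; last by rewrite ltnW.
  exact: leq_trans le_T (ltnW lt_c).
(* With t the entry of c, a diagonal inequality compares the row below c at t + 1 with the row of c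
   at t; monotonicity in i covers the rows further down. *)
rewrite ltnNge -ltnNge leq_tableau_of // -eq_c; apply: leq_trans le_T.
apply: leq_trans (g_col _ _ (ltn_ord _)).
exact: interlacing_anti.
Qed.

Lemma row_count_tableau_of g i k : interlacing N.+1 g -> (k <= N.+1)%N ->
  row_count (tableau_of g) i k = g i k.
Proof.
move=> gI le_kN; have [_ gN _ _] := gI.
have le_g : (g i k <= shape la i)%N by rewrite -gN interlacing_mono.
rewrite row_count_cols -[RHS](card_ord_ltn (leq_trans le_g (shape_leq la i))).
apply: eq_card => j; rewrite inE; apply/imsetP/idP => [[c]|lt_j].
  rewrite inE => /andP[/eqP ci Tc] ->.
  by rewrite ltnNge -ci -leq_tableau_of // -ltnNge.
have [|c [ci cj]] := @exists_cell _ la i j; first exact: leq_trans le_g.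
by exists c; rewrite // inE ci eqxx ltnNge leq_tableau_of // ci cj -ltnNge.
Qed.

Lemma tableau_of_row_count T : semistandard T -> tableau_of (row_count T) = T.
Proof.
move=> sst; apply/ffunP => c; apply: val_inj => /=.
have TI := row_count_interlacing sst.
have leq_T k : (k <= N.+1)%N -> (k <= tableau_of (row_count T) c)%N = (k <= T c)%N.
  by move=> le_k; rewrite leq_tableau_of // leqNgt -ltn_row_count // -leqNgt.
apply/eqP; rewrite eqn_leq -leq_T ?leqnn /=; last by rewrite ltnW.
by rewrite leq_T // ltnW.
Qed.

Lemma eq_tableau_of g g' :
  (forall i k, (k <= N)%N -> g i k = g' i k) -> tableau_of g = tableau_of g'.
Proof.
move=> eq_g; apply/ffunP => c; rewrite !ffunE; congr (inord #|pred_of_set _|).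
by apply/setP => k; rewrite !inE eq_g.
Qed.

(** * The Bender-Knuth involution on patterns *)

Section BenderKnuth.

Variable p : nat.
Hypothesis lt_pN : (p < N)%N.

(* The interlacing conditions confine each entry of column [p + 1], given the
   other columns, to an interval of its own; reflecting all these entries in
   their intervals exchanges the multiplicities of the entries [p] and [p + 1]
   of the tableau. *)
Definition bk_low g i := maxn (g i p) (g i.+1 p.+2).
Definition bk_high g i :=
  if i is j.+1 then minn (g i p.+2) (g j p) else g i p.+2.
Definition bk g i k :=
  if k == p.+1 then (bk_low g i + bk_high g i - g i k)%N else g i k.

Lemma bk_bounds g i : interlacing N.+1 g ->
  (bk_low g i <= g i p.+1 <= bk_high g i)%N.
Proof.
case=> _ _ g_mono g_col; have lt_pN1 : (p < N.+1)%N by rewrite ltnW.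
rewrite geq_max g_mono // g_col //=.
case: i => [|i] /=; first exact: g_mono.
by rewrite leq_min g_mono // g_col.
Qed.

Lemma bk_new_bounds g i : interlacing N.+1 g ->
  (bk_low g i <= bk g i p.+1 <= bk_high g i)%N.
Proof.
move=> gI; have := bk_bounds i gI; rewrite /bk eqxx; lia.
Qed.

(** Only inequalities that meet column p + 1 change, and each of them is one of the terms in the
    maximum [bk_low] or the minimum [bk_high]. *)
Lemma bk_interlacing g : interlacing N.+1 g -> interlacing N.+1 (bk g).
Proof.
move=> gI; have [g0 gN g_mono g_col] := gI; have g_bk i := bk_new_bounds i gI.
have bk_ne i k : k != p.+1 -> bk g i k = g i k by rewrite /bk => /negPf->.
split=> [i|i|i k lt_k|i k lt_k].
- by rewrite bk_ne.
- by rewrite bk_ne // gtn_eqF // ltnS.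
- have [kp|k_p] := eqVneq k p.+1.
    subst k; rewrite [leqRHS]bk_ne; last by rewrite gtn_eqF.
    have /andP[_] := g_bk i; move/leq_trans; apply.
    by case: (i) => //= j; apply: geq_minl.
  have [kp|k_p1] := eqVneq k.+1 p.+1; last by rewrite !bk_ne // g_mono.
  have /andP[le_bk _] := g_bk i; case: kp => kp; subst k.
  by rewrite bk_ne // (leq_trans _ le_bk) // leq_maxl.
have [kp|k_p] := eqVneq k p.+1.
  subst k; rewrite [leqLHS]bk_ne; last by rewrite gtn_eqF.
  have /andP[le_bk _] := g_bk i; apply: leq_trans le_bk.
  exact: leq_maxr.
have [kp|k_p1] := eqVneq k.+1 p.+1; last by rewrite !bk_ne // g_col.
have /andP[_ le_bk] := g_bk i.+1; case: kp => kp; subst k.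
by rewrite (bk_ne _ p) // (leq_trans le_bk) // geq_minr.
Qed.

(** The interval ends depend only on columns p and p + 2, which the reflection leaves alone; since
    the entry lies in its interval, the truncated subtraction is exact. *)
Lemma bkK g : interlacing N.+1 g -> forall i k, bk (bk g) i k = g i k.
Proof.
move=> gI i k; have bnd := bk_bounds i gI.
have bk_ne j l : l != p.+1 -> bk g j l = g j l by rewrite /bk => /negPf->.
rewrite {1}/bk; case: eqP => [->|/eqP/bk_ne //].
have p_ne : p != p.+1 by rewrite neq_ltn ltnSn.
have p2_ne : p.+2 != p.+1 by rewrite neq_ltn ltnSn orbT.
have -> : bk_low (bk g) i = bk_low g i.
  by rewrite /bk_low !bk_ne.
have -> : bk_high (bk g) i = bk_high g i.
  by rewrite /bk_high; case: (i) => [|j]; rewrite !bk_ne.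
rewrite /bk eqxx; lia.
Qed.

Definition bk_tableau T := tableau_of (bk (row_count T)).

Lemma bk_tableau_semistandard T : semistandard T -> semistandard (bk_tableau T).
Proof.
move=> sst; apply/tableau_of_semistandard/bk_interlacing.
exact: row_count_interlacing.
Qed.

Lemma row_count_bk_tableau T i k : semistandard T -> (k <= N.+1)%N ->
  row_count (bk_tableau T) i k = bk (row_count T) i k.
Proof.
move=> sst le_k; rewrite row_count_tableau_of //.
exact/bk_interlacing/row_count_interlacing.
Qed.

Lemma bk_tableauK T : semistandard T -> bk_tableau (bk_tableau T) = T.
Proof.
move=> sst; rewrite -[RHS]tableau_of_row_count //; apply: eq_tableau_of => i k le_k.
rewrite -[RHS](bkK (row_count_interlacing sst)) /bk /bk_low.
have rc j l : (l <= N.+1)%N -> row_count (bk_tableau T) j l = bk (row_count T) j l.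
  exact: row_count_bk_tableau.
have -> : bk_high (row_count (bk_tableau T)) i = bk_high (bk (row_count T)) i.
  by rewrite /bk_high; case: (i) => [|j]; rewrite !rc // ltnW // ltnW.
by rewrite !rc //; [apply: ltnW|rewrite ltnW // ltnW].
Qed.

End BenderKnuth.

End Interlacing.

(** Transpositions generate all permutations, and (i, j+1) is the conjugate of (i, j) by (j,
    j+1). *)
Lemma symmetric_adjacent (R : comNzRingType) N (f : {mpoly R[N]}) :
    (forall i j : 'I_N, j = i.+1 :> nat -> msym (tperm i j) f = f) ->
  f \is symmetric.
Proof.
move=> f_adj; have f_lt (i j : 'I_N) : (i < j)%N -> msym (tperm i j) f = f.
  case: j => j lt_jN /=; elim: j lt_jN => // j IH lt_jN.
  rewrite ltnS leq_eqVlt => /orP[/eqP ij|lt_ij]; first by apply: f_adj; rewrite /= ij.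
  have lt_jN' := ltnW lt_jN; pose j0 := Ordinal lt_jN'; pose j1 := Ordinal lt_jN.
  have -> : tperm i (Ordinal lt_jN) = (tperm i j0 ^ tperm j0 j1)%g.
    by rewrite tpermJ tpermL tpermD // -val_eqE /= gtn_eqF // ltnW.
  have adj : msym (tperm j0 j1) f = f by apply: f_adj.
  by rewrite conjgE tpermV !msymMm adj IH ?adj.
apply/issymP => s; case: (prod_tpermP s) => ts -> /allP ts_neq.
rewrite big_seq; elim/big_rec: _ => [|t r t_ts IH]; first exact: msym1m.
rewrite msymMm; have := ts_neq t t_ts; rewrite /dpair /= neq_ltn => /orP[/f_lt->|/f_lt].
  exact: IH.
by rewrite tpermC => ->.
Qed.

(** * Contents of tableaux and symmetry of Schur functions *)

Section SchurContent.

Variables (n : nat) (la : part n) (N : nat).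
Implicit Types T : {ffun cell la -> 'I_N}.

Definition content T : 'X_{1..N} := (\sum_(c : cell la) U_(T c))%MM.

Lemma contentE T i : content T i = (\sum_(c : cell la) (T c == i))%N.
Proof. by rewrite /content mnm_sumE; apply: eq_bigr => c _; rewrite mnm1E. Qed.

Lemma sym_sE : sym_s la N = \sum_(T | semistandard T) 'X_[content T].
Proof. by apply: eq_bigr => T _; rewrite /content -mprodXE. Qed.

Lemma sum_row_count T k :
  (\sum_(i < n) row_count T i k = \sum_(c : cell la) (T c < k))%N.
Proof.
rewrite /row_count; under eq_bigr => i _ do rewrite -sum1_card big_mkcond.
rewrite exchange_big; apply: eq_bigr => c _ /=.
rewrite (bigD1 (val c).1) //= inE eqxx /= big1 ?addn0 => [|i].
  by case: (T c < k)%N.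
by rewrite inE val_eqE eq_sym => /negPf->.
Qed.

Lemma sum_row_countS T (i : 'I_N) :
  (\sum_(j < n) row_count T j i.+1 = \sum_(j < n) row_count T j i + content T i)%N.
Proof.
rewrite !sum_row_count contentE -big_split; apply: eq_bigr => c _ /=.
by rewrite ltnS leq_eqVlt -val_eqE /=; case: ltngtP.
Qed.

Lemma card_row_cells T i : semistandard T ->
  (\sum_(c : cell la) ((val c).1 == i :> nat) = shape la i)%N.
Proof.
move=> sst; have [_ <- _ _] := row_count_interlacing sst.
rewrite /row_count -sum1_card [RHS]big_mkcond; apply: eq_bigr => c _ /=.
by rewrite inE ltn_ord andbT; case: (_ == _).
Qed.

Lemma mdeg_content T : semistandard T -> mdeg (content T) = n.
Proof.
move=> sst; rewrite /content mdeg_sum; under eq_bigr => c _ do rewrite mdeg1.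
rewrite -[RHS](sum_shape la); under [RHS]eq_bigr => i _ do rewrite -(card_row_cells i sst).
rewrite exchange_big; apply: eq_bigr => c _ /=.
rewrite (bigD1 (val c).1) //= eqxx big1 ?addn0 // => i.
by rewrite -val_eqE eq_sym => /negPf /= ->.
Qed.

Lemma mcoeff_sym_s (a : 'X_{1..N}) :
  (sym_s la N)@_a = #|[pred T | semistandard T && (content T == a)]|%:R.
Proof.
rewrite sym_sE raddf_sum -sum1_card natr_sum /= [LHS]big_mkcond [RHS]big_mkcond.
apply: eq_bigr => T _; rewrite mcoeffX inE.
by case: (semistandard T); case: (_ == _).
Qed.

Lemma mcoeff_sym_s_neq0 (a : 'X_{1..N}) :
  (sym_s la N)@_a != 0 <-> exists2 T, semistandard T & content T = a.
Proof.
rewrite mcoeff_sym_s pnatr_eq0 -lt0n; split.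
  by case/card_gt0P => T /andP[sst /eqP]; exists T.
by case=> T sst Ta; apply/card_gt0P; exists T; apply/andP; split=> //; apply/eqP.
Qed.

Lemma leq_row_semistandard T (c : cell la) : semistandard T -> ((val c).1 <= T c)%N.
Proof.
move=> sst; move: {2}(val (val c).1) (erefl (val (val c).1)) => i.
elim: i c => [|i IH] c ci; first by rewrite [X in (X <= _)%N]ci.
have [|c' [c'i eq2]] := @exists_cell _ la i (val c).2.
  by apply: leq_trans (shape_decr la i); rewrite -ci cell_ltn.
rewrite [X in (X <= _)%N]ci -c'i; apply: leq_ltn_trans (IH c' c'i) _.
by apply: semistandard_col; rewrite // c'i [X in (_ < X)%N]ci.
Qed.

End SchurContent.

(** The multiplicities of i and i + 1 are consecutive differences of the column sums s at i, i + 1,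
    i + 2. Exchanging them means replacing the middle sum by s i + s (i + 2) - s (i + 1), which is
    what reflecting in all the intervals does. *)
Lemma content_bk_tableau n (la : part n) N (T : {ffun cell la -> 'I_N.+1})
    (i j : 'I_N.+1) : j = i.+1 :> nat -> semistandard T ->
  content (bk_tableau i T) = [multinom content T (tperm i j k) | k < N.+1].
Proof.
move=> ij sst; have lt_iN : (i < N)%N by rewrite -ltnS -ij ltn_ord.
have TI := row_count_interlacing sst.
pose s k := (\sum_(l < n) row_count T l k)%N.
pose s' k := (\sum_(l < n) row_count (bk_tableau i T) l k)%N.
have s'E k : (k <= N.+1)%N -> k != i.+1 -> s' k = s k.
  move=> le_k k_i; apply: eq_bigr => l _.
  by rewrite row_count_bk_tableau // /bk (negPf k_i).
have sS (k : 'I_N.+1) : s k.+1 = (s k + content T k)%N := sum_row_countS T k.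
have s'S (k : 'I_N.+1) : s' k.+1 = (s' k + content (bk_tableau i T) k)%N.
  exact: sum_row_countS.
have s'i : (s' i.+1 + s i.+1 = s i + s i.+2)%N.
  pose g := row_count T.
  have gn k : (k <= N.+1)%N -> g n k = 0%N.
    move=> le_k; apply/eqP; rewrite -leqn0 -[leqRHS](shape_default la (leqnn n)).
    have [_ <- _ _] := TI; exact: (interlacing_mono n TI le_k (leqnn _)).
  rewrite /s' /s -big_split.
  transitivity (\sum_(l < n) (bk_low i g l + bk_high i g l))%N.
    apply: eq_bigr => l _; rewrite /= row_count_bk_tableau // 1?ltnW // /bk eqxx.
    by have := bk_bounds lt_iN l TI; rewrite -/g; lia.
  rewrite big_split /=.
  (* Row n is empty, so the sum may be shifted by one row. The term of [bk_high] at l + 1 is then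
     the minimum of the two numbers whose maximum is [bk_low] at l, and the two add up to the sum of
     these numbers. *)
  have -> : (\sum_(l < n) bk_high i g l =
      g 0 i.+2 + \sum_(l < n) minn (g l.+1 i.+2) (g l i))%N.
    have high_n : bk_high i g n = 0%N.
      have le_high m : (bk_high i g m <= g m i.+2)%N.
        by case: m => //= m; apply: geq_minl.
      by apply/eqP; rewrite -leqn0 (leq_trans (le_high n)) // gn.
    rewrite -[RHS](big_ord_recl n (fun l => bk_high i g l)) big_ord_recr /=.
    by rewrite high_n addn0.
  have gS : (g 0 i.+2 + \sum_(l < n) g l.+1 i.+2 = \sum_(l < n) g l i.+2)%N.
    by rewrite -[LHS](big_ord_recl n (fun l => g l i.+2)) big_ord_recr /= gn ?addn0.
  rewrite addnCA -big_split -gS addnCA -big_split; congr (_ + _)%N.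
  apply: eq_bigr => l _; rewrite /bk_low /= -/(g l i); lia.
have ltnW_ord (k : 'I_N.+1) : (k <= N.+1)%N := ltnW (ltn_ord k).
apply/mnmP => k; rewrite mnmE.
have [->|k_i] := eqVneq k i.
  rewrite tpermL; have := sS j; have := s'S i.
  rewrite ij (s'E i) //; last by rewrite neq_ltn ltnSn.
  by move: s'i; lia.
have [->|k_j] := eqVneq k j.
  rewrite tpermR; have := s'S j; have := sS i.
  rewrite ij (s'E i.+2) //; last by rewrite neq_ltn ltnSn orbT.
  by move: s'i; lia.
rewrite tpermD 1?eq_sym //; have := s'S k; have := sS k.
rewrite !s'E ?eqSS // 1?ltnW //; first by move=> -> /addnI.
by rewrite -ij.
Qed.

Lemma sym_s_Lambda n (la : part n) : in_Lambda n (sym_s la).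
Proof.
move=> N; split.
- apply: symmetric_adjacent; case: N => [[]//|N] i j ij.
  rewrite sym_sE raddf_sum /=.
  have lt_iN : (i < N)%N by rewrite -ltnS -ij ltn_ord.
  rewrite [RHS](reindex_onto (@bk_tableau _ la N i) (@bk_tableau _ la N i)) /=; last first.
    by move=> T sst; apply: bk_tableauK.
  rewrite [RHS](eq_bigl (fun T : {ffun cell la -> 'I_N.+1} => semistandard T)).
    apply: eq_bigr => T sst; rewrite msymX tpermV; congr 'X_[_].
    by rewrite (content_bk_tableau ij sst).
  move=> T; apply/andP/idP => [[sst /eqP <-]|sst].
    exact: bk_tableau_semistandard.
  by rewrite bk_tableau_semistandard // bk_tableauK.
- rewrite sym_sE; apply: rpred_sum => T sst.
  by rewrite dhomogX; apply/eqP/mdeg_content.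
(* Setting the last variable to 0 keeps the tableaux that avoid the last letter; these are the image
   under h of the tableaux in the smaller alphabet. *)
pose h (T : {ffun cell la -> 'I_N}) : {ffun cell la -> 'I_N.+1} :=
  [ffun c => widen_ord (leqnSn N) (T c)].
have h_inj : injective h.
  move=> T T' eq_h; apply/ffunP => c; apply: val_inj.
  by have := congr1 (fun f : {ffun _ -> _} => val (f c)) eq_h; rewrite /= !ffunE.
have h_sst T : semistandard (h T) = semistandard T.
  by apply: eq_forallb => c; apply: eq_forallb => c'; rewrite !ffunE.
rewrite !sym_sE /kill_last raddf_sum /=.
under eq_bigr => T _ do rewrite -/(kill_last _) kill_lastX.
pose A := [set T : {ffun cell la -> 'I_N.+1} | semistandard T & content T ord_max == 0%N].
transitivity (\sum_(T in A)
    'X_[rat, [multinom content T (widen_ord (leqnSn N) i) | i < N]]).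
  rewrite big_mkcond [RHS]big_mkcond; apply: eq_bigr => T _; rewrite inE.
  by case: (semistandard T); case: (_ == _).
have -> : A = h @: [set T | semistandard T].
  apply/setP => T; rewrite inE; apply/andP/imsetP => [[sst]|[T']].
    rewrite contentE sum_nat_eq0 => /forallP T_max.
    have T_lt c : (T c < N)%N.
      have := T_max c; rewrite implyTb eqb0 => T_c.
      by rewrite ltn_neqAle -ltnS ltn_ord andbT.
    pose T' : {ffun cell la -> 'I_N} := [ffun c => Ordinal (T_lt c)].
    have TT' : T = h T' by apply/ffunP => c; apply: val_inj; rewrite /= !ffunE.
    by exists T' => //; rewrite inE -h_sst -TT'.
  rewrite inE => sst ->; rewrite h_sst; split=> //.
  rewrite contentE sum_nat_eq0; apply/forallP => c; rewrite ffunE eqb0.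
  by rewrite -val_eqE /= ltn_eqF.
rewrite big_imset => [|T T' _ _]; last exact: h_inj.
apply: eq_big => [T|T _]; first by rewrite inE.
congr 'X_[_]; apply/mnmP => i; rewrite mnmE !contentE.
by apply: eq_bigr => c _; rewrite ffunE.
Qed.

(** The rank r is the statistic n(la), the sum of the row indices of the cells counted from 0; for a
    tableau of content mu the entries sum to r mu. Entries being at least their row indices, r la <=
    r mu, and equality forces every entry to be its row index, so that mu = la. *)
Lemma mcoeff_mx_s_unit n : mcoeff_mx (@sym_s n) \in unitmx.
Proof.
pose r (la : part n) := (\sum_(i < n) shape la i * i)%N.
have rE (la : part n) T : semistandard (T : {ffun cell la -> 'I_n}) ->
    r la = (\sum_(c : cell la) (val c).1)%N.
  move=> sst; rewrite /r; under eq_bigr => i _ do rewrite -(card_row_cells i sst) big_distrl.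
  rewrite exchange_big; apply: eq_bigr => c _ /=.
  rewrite (bigD1 (val c).1) //= eqxx mul1n big1 ?addn0 // => i.
  by rewrite -val_eqE eq_sym => /negPf /= ->.
have contentr (la mu : part n) (T : {ffun cell la -> 'I_n}) :
    content T = mnm_part mu -> r mu = (\sum_(c : cell la) T c)%N.
  move=> Tmu; rewrite /r; under eq_bigr => i _.
    rewrite shapeE -(mnmE (fun j => row_len mu j)) -/(mnm_part mu) -Tmu contentE.
    rewrite big_distrl; over.
  rewrite exchange_big; apply: eq_bigr => c _ /=.
  rewrite (bigD1 (T c)) //= eqxx mul1n big1 ?addn0 // => i.
  by rewrite eq_sym => /negPf->.
have rowT (la : part n) (T : {ffun cell la -> 'I_n}) : semistandard T ->
    (forall c, T c = (val c).1) -> content T = mnm_part la.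
  move=> sst Tc; apply/mnmP => i; rewrite contentE mnmE -shapeE -(card_row_cells i sst).
  by apply: eq_bigr => c _; rewrite Tc.
apply: (@triangular_unitmx _ _ _ (fun i => r (enum_val i))) => [i|i j].
  set la := enum_val i; rewrite mxE -/la; apply/mcoeff_sym_s_neq0.
  pose T : {ffun cell la -> 'I_n} := [ffun c => (val c).1].
  have sst : semistandard T.
    apply/forallP => c; apply/forallP => c'; rewrite !ffunE.
    by apply/andP; split; apply/implyP => /andP[/eqP eq_c lt_c] //; rewrite eq_c.
  by exists T => //; apply: rowT => // c; rewrite ffunE.
set la := enum_val i; set mu := enum_val j; rewrite mxE -/la -/mu.
case/mcoeff_sym_s_neq0 => T sst Tmu; rewrite (rE la T sst) (contentr la mu T Tmu).
have le_T (c : cell la) : ((val c).1 <= T c)%N by apply: leq_row_semistandard.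
case: (boolP [forall c, (val c).1 == T c]) => [/forallP eqT|/forallPn[c neqT]].
  left; apply: enum_val_inj; apply: perm_parts_inj.
  rewrite -/la -/mu -!nonzero_mnm_part -Tmu (rowT la T) // => c.
  by rewrite (eqP (eqT c)).
right; rewrite (bigD1 c) //= [ltnRHS](bigD1 c) //= -addSn leq_add //.
  by rewrite ltn_neqAle le_T andbT.
by apply: leq_sum => c' _; apply: le_T.
Qed.

Lemma sym_s_basis n : is_basis (@sym_s n).
Proof.
apply: is_basis_transition (@sym_m_basis n) _ (mcoeff_mx_s_unit n).
exact/is_transition_mcoeff/sym_s_Lambda.
Qed.

(** * Transition matrices from the truncated basis *)

Lemma mulmx_part_diag n m (M : 'M[rat]_(m, #|{: part n}|)) (F : part n -> rat) i j :
  (M *m part_diag F) i j = M i j * F (enum_val j).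
Proof. by rewrite /part_diag mul_mx_diag !mxE. Qed.

Lemma eq_transition n (a a' b : part n -> symfun) M :
  (forall la N, a la N = a' la N) -> is_transition a b M -> is_transition a' b M.
Proof. by move=> eq_a abM la N; rewrite -eq_a. Qed.

Lemma eq_part_diag n (F G : part n -> rat) : F =1 G -> part_diag F = part_diag G.
Proof. by move=> eqFG; congr diag_mx; apply/rowP => i; rewrite !mxE eqFG. Qed.

Lemma part_diag1 n : part_diag (fun _ : part n => 1) = 1%:M.
Proof. by apply/matrixP => i j; rewrite !mxE. Qed.

Lemma is_transition_hd_p d n : is_transition (@sym_hd d n) (@sym_p n)
  ((mcoeff_mx (@sym_p n))^T *m invmx (zmx n) *m Dmx d n).
Proof.
move=> la N; rewrite sym_hd_sym_p; apply: eq_bigr => mu _; congr (_ *: _).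
rewrite /zmx invmx_part_diag; last exact: zval_neq0.
by rewrite !mulmx_part_diag !mxE !enum_rankK -mulrA [(Dval _ _ / _)]mulrC.
Qed.

Theorem corollary2p8 (d n : nat) (hd : (0 < d)%N) :
  let h_d := @sym_hd d n in
  let p := @sym_p n in
  let m := @sym_m n in
  let h := @sym_h n in
  let e := @sym_e n in
  let s := @sym_s n in
  let R := transition p m in
  let K := transition s m in
  let Rstar := invmx R^T in
  let z := zmx n in
  let eps := epsmx n in
  let D := Dmx d n in
  (is_basis h_d /\
   [/\ is_basis p, is_basis m, is_basis h, is_basis e & is_basis s]) /\
  [/\ transition h_d p = R^T *m invmx z *m D,
      transition h_d m = R^T *m invmx z *m D *m R,
      transition h_d h = R^T *m D *m Rstar,
      transition h_d e = R^T *m D *m eps *m Rstar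
    & transition h_d s = R^T *m invmx z *m D *m R *m invmx K].
Proof.
move=> h_d p m h e s R K Rstar z eps D.
have pm : is_transition p m (mcoeff_mx p) := is_transition_mcoeff (@sym_p_Lambda n).
have sm : is_transition s m (mcoeff_mx s) := is_transition_mcoeff (@sym_s_Lambda n).
have m_basis : is_basis m := @sym_m_basis n.
have p_basis : is_basis p := @sym_p_basis n.
have RE : R = mcoeff_mx p := transition_eq m_basis pm.
have KE : K = mcoeff_mx s := transition_eq m_basis sm.
have uR : R^T \in unitmx by rewrite unitmx_tr RE mcoeff_mx_p_unit.
have uK : K \in unitmx by rewrite KE mcoeff_mx_s_unit.
rewrite -RE in pm; rewrite -KE in sm.
have zE : invmx z = part_diag (fun la => (zval la)^-1).
  exact/invmx_part_diag/zval_neq0.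
have uz : invmx z \in unitmx.
  by rewrite unitmx_inv; apply: part_diag_unit; apply: zval_neq0.
(* The parameter is not assumed positive here: the case d' = n, used for h, includes n = 0. *)
have transp d' : is_transition (@sym_hd d' n) p (R^T *m invmx z *m Dmx d' n).
  by rewrite RE; apply: is_transition_hd_p.
have hp : is_transition h p (R^T *m invmx z).
  have -> : R^T *m invmx z = R^T *m invmx z *m Dmx n n.
    by rewrite /Dmx (eq_part_diag (@Dval_large n)) part_diag1 mulmx1.
  exact: eq_transition (@sym_hdn n) (transp n).
have ep : is_transition e p (R^T *m invmx z *m eps).
  rewrite /eps /epsmx -(eq_part_diag (@Dval1 n)).
  exact: eq_transition (@sym_hd1 n) (transp 1%N).
(* Positivity of d keeps the powers of -d on the diagonal nonzero, which makes the h^[d] a basis. *)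
have uD : D \in unitmx by apply: part_diag_unit => la; apply: Dval_neq0.
have ueps : eps \in unitmx.
  by apply: part_diag_unit => la; rewrite expf_neq0 // oppr_eq0 oner_eq0.
have uh : R^T *m invmx z \in unitmx by rewrite unitmx_mul uR.
have ue : R^T *m invmx z *m eps \in unitmx by rewrite unitmx_mul uh.
have uhd : R^T *m invmx z *m D \in unitmx by rewrite unitmx_mul uh.
have h_basis := is_basis_transition p_basis hp uh.
have e_basis := is_basis_transition p_basis ep ue.
have s_basis : is_basis s := @sym_s_basis n.
have hdm := is_transition_comp (transp d) pm.
split; first by split=> //; apply: is_basis_transition p_basis (transp d) uhd.
split; apply: transition_eq => //.
- exact: transp.
(* Passing through p, the matrix is M(h^[d], p) M(h, p)^-1, and z^-1 cancels past D. *)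
- have -> : R^T *m D *m Rstar = R^T *m invmx z *m D *m invmx (R^T *m invmx z).
    apply: (canRL (mulmxK uh)); rewrite /Rstar -!mulmxA (mulKmx uR) zE part_diagM.
    by rewrite part_diagM; congr (_ *m _); apply: eq_part_diag => la; rewrite mulrC.
  exact: is_transition_comp (transp d) (is_transition_inv hp uh).
(* The same cancellation for e, where eps is its own inverse. *)
- have -> : R^T *m D *m eps *m Rstar =
      R^T *m invmx z *m D *m invmx (R^T *m invmx z *m eps).
    apply: (canRL (mulmxK ue)); rewrite /Rstar -!mulmxA (mulKmx uR) zE !part_diagM.
    congr (_ *m _); apply: eq_part_diag => la.
    by rewrite [epsval la * _]mulrCA /epsval -expr2 sqrr_sign mulr1 mulrC.
  exact: is_transition_comp (transp d) (is_transition_inv ep ue).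
- exact: is_transition_comp hdm (is_transition_inv sm uK).
Qed.
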